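(* In the setting of the context (generalized Gauss-Newton formulation), let hypotheses (B1)--(B8) of the context hold, with $c_{tc}$ in (B5) sufficiently small. Let, for each $\delta$, the parameters $\beta_k$ and discretizations $h=h_k$ be such that $$\tilde{\underline\theta}\, I_{3,h}^{k}\le I_{2,h}^{k}\le \tilde{\overline\theta}\, I_{3,h}^{k},$$ let $k_*=k_*(\delta)=\min\{k\in\mathbb{N} : I_{3,h}^{k}\le \tau^2\delta^2\}$, and let $(q^k_{h_k},u^k_{h_k})$ be the primal part of a KKT point of the discretized constrained problem of the context. Then: (i) $\|q^k_{h_k}-q_0\|^2+\|u^k_{h_k}-u_0\|^2\le \|q^\dagger-q_0\|^2+\|u^\dagger-u_0\|^2$ for all $0\le k\le k_*$; (ii) $k_*$ is finite; (iii) $(q_h^{k_*},u_h^{k_*})=(q^{k_*(\delta),\delta}_{h_{k_*(\delta)}},u^{k_*(\delta),\delta}_{h_{k_*(\delta)}})$ converges (weakly) subsequentially to a solution of $\mathbf F(q,u)=\mathbf g$ as $\delta\to0$, in the sense that it has a weakly convergent subsequence and each weakly convergent subsequence converges strongly to a solution of $\mathbf F(q,u)=\mathbf g$. If the solution $(q^\dagger,u^\dagger)$ of $\mathbf F(q,u)=\mathbf g$ is unique, then $(q_h^{k_*},u_h^{k_*})$ converges strongly to $(q^\dagger,u^\dagger)$ as $\delta\to0$.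
   Context: Setting. $Q,V,G,W$ are Hilbert spaces, $W^*$ is the dual of $W$. $A:\mathcal D(A)\subseteq Q\times V\to W^*$ and $C:\mathcal D(C)\subseteq V\to G$ are (generally nonlinear) operators with derivatives $A'_q,A'_u,C'$; $f\in W^*$, $g\in G$. The all-at-once system is $\mathbf F(q,u)=\mathbf g$ with $\mathbf F(q,u)=(C(u),A(q,u))\in G\times W^*$, $\mathbf g=(g,f)$. Noisy data $g^\delta\in G$ satisfy $\|g-g^\delta\|_G\le\delta$. $(q_0,u_0)\in Q\times V$ is an initial guess and $\mathcal B_\rho(q_0,u_0)$ the ball of radius $\rho$ in $Q\times V$, normed by $\|(q,u)\|_{Q\times V}^2=\|q\|_Q^2+\|u\|_V^2$; norms without index are those of $Q$ and $V$. Iteration. In step $k\ge1$, $Q,V,W$ are replaced by finite dimensional subspaces $Q_{h_k},V_{h_k},W_{h_k}$ (possibly different for each $k$; one writes $h=h_k$). $\|\cdot\|_{W_h^*}$ denotes the dual norm with respect to $W_h$ and $\|\cdot\|_{V_{h}}$ the norm of $V_h$. The iteration starts with $(q^0_{h_0},u^0_{h_0})=(q_0,u_0)$, and $(q_{\rm old},u_{\rm old})=(q^k_{\rm old},u^k_{\rm old})=(q^{k-1}_{h_{k-1}},u^{k-1}_{h_{k-1}})$ is the previous iterate, which is not re-discretized in step $k$. With $L_{k-1}=A'_q(q_{\rm old},u_{\rm old})$, $K_{k-1}=A'_u(q_{\rm old},u_{\rm old})$ and regularization parameter $\beta_k>0$, the discretized constrained problem is $$\min_{(q,u)\in Q_{h_k}\times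 V_{h_k}}\|C(u_{\rm old})+C'(u_{\rm old})(u-u_{\rm old})-g^\delta\|_G^2+\tfrac1{\beta_k}\big(\|q-q_0\|_Q^2+\|u-u_0\|_{V_{h_k}}^2\big)$$ $$\text{s.t. } L_{k-1}(q-q_{\rm old})+K_{k-1}(u-u_{\rm old})+A(q_{\rm old},u_{\rm old})=f\ \text{ in }W_{h_k}^* ,$$ and $(q^k_h,u^k_h)=(q^k_{h_k},u^k_{h_k})$ is the primal part of a KKT point of it. The auxiliary continuous iterate $(q^k,u^k)$ is the solution of the same problem with $Q,V,W^*$ in place of $Q_{h_k},V_{h_k},W_{h_k}^*$ (same $(q_{\rm old},u_{\rm old})$, $\beta_k$), with Lagrange multiplier (adjoint state) $z^k\in W$; that is, $(q^k,u^k,z^k)$ is a stationary point on $Q\times V\times W$ of the Lagrangian $$\mathcal L(q,u,z)=\|C(u_{\rm old})+C'(u_{\rm old})(u-u_{\rm old})-g^\delta\|_G^2+\tfrac1{\beta_k}\big(\|q-q_0\|_Q^2+\|u-u_0\|_V^2\big)+\langle f-A(q_{\rm old},u_{\rm old})-L_{k-1}(q-q_{\rm old})-K_{k-1}(u-u_{\rm old}),z\rangle_{W^*,W}.$$ All iterates depend on $\delta$. Penalty parameter. $c_{\rm adj}$ denotes a constant independent of $k$ such that $\|z^k\|_W\le c_{\rm adj}(\|q_{\rm old}-q_0\|_Q+\|u_{\rm old}-u_0\|_V+1)$ whenever $(q_{\rm old},u_{\rm old})\in\mathcal B_\rho(q_0,u_0)$ and $(q^k,u^k,z^k)\in Q\times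 V\times W$ is a stationary point of the Lagrangian $\mathcal L$, i.e. $\mathcal L'_q(q^k,u^k,z^k)=0$, $\mathcal L'_u(q^k,u^k,z^k)=0$ and $\mathcal L'_z(q^k,u^k,z^k)=0$ (similarly for the discretized problems), and $\varrho>0$ is fixed with $\varrho\ge c_{\rm adj}(\|q^\dagger-q_0\|_Q+\|u^\dagger-u_0\|_V+1)$. Quantities of interest. Define $$I_2(u_{\rm old},u)=\|C'(u_{\rm old})(u-u_{\rm old})+C(u_{\rm old})-g^\delta\|_G^2,\qquad I_1(u_{\rm old},q,u,\beta)=I_2(u_{\rm old},u)+\tfrac1\beta(\|q-q_0\|_Q^2+\|u-u_0\|_V^2),$$ $$I_3(q_{\rm old},u_{\rm old})=\|C(u_{\rm old})-g^\delta\|_G^2+\varrho\|A(q_{\rm old},u_{\rm old})-f\|_{W^*},\qquad I_4(q,u)=\|C(u)-g^\delta\|_G^2+\varrho\|A(q,u)-f\|_{W^*},$$ and let $I_{1,h},\dots,I_{4,h}$ be the same expressions with $\|\cdot\|_V$ replaced by $\|\cdot\|_{V_{h_k}}$ and $\|\cdot\|_{W^*}$ by $\|\cdot\|_{W_{h_k}^*}$ (so $I_{2,h}=I_2$). Set $I_1^k=I_1(u^k_{\rm old},q^k,u^k,\beta_k)$, $I_2^k=I_2(u^k_{\rm old},u^k)$, $I_3^k=I_3(q^k_{\rm old},u^k_{\rm old})$, $I_4^k=I_4(q^k,u^k)$, and $I_{1,h}^k=I_{1,h}(u^k_{\rm old},q^k_{h_k},u^k_{h_k},\beta_k)$, $I_{2,h}^k=I_{2,h}(u^k_{\rm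 old},u^k_{h_k})$, $I_{3,h}^k=I_{3,h}(q^k_{\rm old},u^k_{\rm old})$, $I_{4,h}^k=I_{4,h}(q^k_{h_k},u^k_{h_k})$. Hypotheses. (B1) There is a solution $(q^\dagger,u^\dagger)\in\mathcal B_\rho(q_0,u_0)\subset\mathcal D(A)\cap(Q\times\mathcal D(C))$ of $\mathbf F(q,u)=\mathbf g$. (B2) The PDE $A(q,u)=f$ (for $u$, given $q$), and especially also its linearization at $(q,u)$, is uniquely and stably solvable (in particular $A'_u(q,u):V\to W^*$ has a bounded inverse). (B3) The norms in $G$ and $Q$, the operator $C$ and the semilinear form $a(q,u)(v)=\langle A(q,u),v\rangle_{W^*,W}$ are evaluated exactly. (B4) $\mathbf F$ is continuous and weakly sequentially closed: for all sequences $(q_n,u_n)$ in $Q\times V$, if $q_n\rightharpoonup q$, $u_n\rightharpoonup u$, $C(u_n)\to g$, $A(q_n,u_n)\to f$, then $u\in\mathcal D(C)$, $(q,u)\in\mathcal D(A)$, $C(u)=g$ and $A(q,u)=f$. (B5) There are $0<c_{tc}<1$ and $\rho>0$ such that for all $(q,u),(\bar q,\bar u)\in\mathcal B_\rho(q_0,u_0)$ $$\|C(u)-C(\bar u)-C'(u)(u-\bar u)\|_G\le c_{tc}\|C(u)-C(\bar u)\|_G,$$ $$\|A(q,u)-A(\bar q,\bar u)-A'_q(q,u)(q-\bar q)-A'_u(q,u)(u-\bar u)\|_{W^*}\le 4c_{tc}^2\|A(q,u)-A(\bar q,\bar u)\|_{W^*}.$$ (B6) $\tau,\tilde{\underline\theta}$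 are sufficiently large and $\tilde{\overline\theta}$ is sufficiently small that $$2\Big(c_{tc}^2+\frac{(1+c_{tc})^2}{\tau^2}\Big)<\tilde{\underline\theta},\qquad \frac{2\tilde{\overline\theta}+4c_{tc}^2}{1-4c_{tc}^2}<1 .$$ (B7) $|I_{i,h}^k-I_i^k|\le\eta_i^k$ for $i\in\{1,2,3,4\}$, where $$\eta_1^k+4c_{tc}^2\eta_3^k\le\Big(\tilde{\underline\theta}-2\Big(2c_{tc}^2+\frac{(1+2c_{tc})^2}{\tau^2}\Big)\Big)I_{3,h}^k,$$ $$\eta_3^k\le c_1I_{3,h}^k,\qquad \eta_2^k\to0,\ \eta_3^k\to0,\ \eta_4^k\to0\ \text{ as }k\to\infty,$$ $$I_{3,h}^k\le(1+c_3)I_{4,h}^{k-1}+r^k,\qquad (1+c_3)\frac{2\tilde{\overline\theta}+4c_{tc}^2}{1-4c_{tc}^2}\le c_2<1,$$ for some constants $c_1,c_2,c_3>0$ and a sequence $r^k\to0$ as $k\to\infty$. (B8) $\displaystyle\sup_{(q,u)\in\mathcal B_\rho(q_0,u_0)}\big(\|A(q,u)\|_{W^*}+\|A'_q(q,u)\|_{Q\to W^*}+\|A'_u(q,u)^*\|_{W^*\to V}+\|A'_u(q,u)^{-1}\|_{W^*\to V}\big)<\infty$ and $\displaystyle\sup_{u\in\mathcal B_\rho(u_0)}\big(\|C(u)\|_G+\|C'(u)\|_{V\to G}\big)<\infty$.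
   Formalization: k_* is taken as the first k≥0 whose iterate (q_h^k,u_h^k) satisfies the discrepancy principle, i.e. I_{3,h}^{k+1}≤τ²δ² (with the literal index, (i) and (iii) fail at k_* ); the norm of V_h is assumed to dominate that of V, e.g. the inherited norm. *)

(* Defs.v *)
From HB Require Import structures.
From mathcomp Require Import all_boot all_order all_algebra.
From mathcomp Require Import all_classical all_reals all_analysis.
Set Implicit Arguments.
Unset Strict Implicit.
Unset Printing Implicit Defensive.
Import Order.TTheory GRing.Theory Num.Theory.
Import numFieldNormedType.Exports.
Local Open Scope classical_set_scope.
Local Open Scope ring_scope.

HB.mixin Record isInnerProductNorm (R : realType) V & NormedModule R V := {
  inner : V -> V -> R;
  innerC : forall x y, inner x y = inner y x;
  innerDl : forall x y z, inner (x + y) z = inner x z + inner y z;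
  innerZl : forall a x y, inner (a *: x) y = a * inner x y;
  inner_norm : forall x, inner x x = `|x| ^+ 2 }.

#[short(type="hilbertType")]
HB.structure Definition Hilbert (R : realType) :=
  {V of CompleteNormedModule R V & isInnerProductNorm R V}.

Section dual_space.
Context {R : realType} {V : normedModType R}.
Implicit Types (S : set V).

Definition dual_pred : {pred (V -> R^o)} :=
  mem [set f : V -> R^o | linear f /\ continuous f].

Record dual := Dual { dual_fun :> V -> R^o ; _ : dual_fun \in dual_pred }.

HB.instance Definition _ := [isSub for dual_fun].
HB.instance Definition _ := [Choice of dual by <:].

Lemma dual_pred_submod : submod_closed dual_pred.
Proof.
split => [|a f g].
  apply/mem_set; split => [a x y|x]; last exact: cvg_cst.
  by rewrite /= /GRing.zero /= scaler0 addr0.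
move=> /set_mem[lf cf] /set_mem[lg cg]; apply/mem_set; split.
  move=> b x y; rewrite /= !fctE lf lg !scalerDr addrACA !scalerA.
  by rewrite (mulrC a).
by move=> x; apply: cvgD; [apply: cvgZl_tmp; exact: cf|exact: cg].
Qed.

HB.instance Definition _ := GRing.isSubmodClosed.Build _ _ dual_pred
  dual_pred_submod.
HB.instance Definition _ := [SubChoice_isSubLmodule of dual by <:].

Definition dual_norm_on S (f : dual) : R :=
  sup [set `|f x| | x in [set x | S x /\ `|x| <= 1]].

Lemma dual_linear (f : dual) : linear f.
Proof. by case: f => f /= /set_mem[]. Qed.

Lemma dual_continuous (f : dual) : continuous f.
Proof. by case: f => f /= /set_mem[]. Qed.

HB.instance Definition _ (f : dual) :=
  GRing.isLinear.Build R V R^o _ f (dual_linear f).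

Lemma dual_norm_has_sup (f : dual) :
  has_sup [set `|f x| | x in [set x | setT x /\ `|x| <= 1]].
Proof.
split; first by exists `|f 0|, 0 => //; split => //; rewrite normr0.
have /linear_bounded_continuous/linear_boundedP := @dual_continuous f.
move=> /pinfty_ex_gt0[r r0 fr]; exists r => _ [x [_ x1] <-].
by rewrite (le_trans (fr x))// ler_piMr// ltW.
Qed.

Lemma dual_norm_ub (f : dual) x : `|f x| <= dual_norm_on setT f * `|x|.
Proof.
have [->|x0] := eqVneq x 0; first by rewrite linear0 !normr0 mulr0.
rewrite -ler_pdivrMr ?normr_gt0//.
apply: (sup_upper_bound (dual_norm_has_sup f)).
exists (`|x|^-1 *: x).
  by split => //; rewrite normrZ normfV normr_id mulVf ?normr_eq0.
by rewrite linearZ normrZ normfV normr_id mulrC.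
Qed.

Lemma dual_norm_le (f : dual) (M : R) :
  (forall x, `|x| <= 1 -> `|f x| <= M) -> dual_norm_on setT f <= M.
Proof.
move=> fM; apply: ge_sup; first by have [] := dual_norm_has_sup f.
by move=> _ [x [_ x1] <-]; exact: fM.
Qed.

Lemma dual_norm_ub1 (f : dual) x : `|x| <= 1 -> `|f x| <= dual_norm_on setT f.
Proof.
by move=> x1; apply: (sup_upper_bound (dual_norm_has_sup f)); exists x.
Qed.

Lemma dual_normD (f g : dual) :
  dual_norm_on setT (f + g) <= dual_norm_on setT f + dual_norm_on setT g.
Proof.
apply: dual_norm_le => x x1.
by rewrite (le_trans (ler_normD _ _))// lerD// dual_norm_ub1.
Qed.

Lemma dual_normZ (a : R) (f : dual) :
  dual_norm_on setT (a *: f) = `|a| * dual_norm_on setT f.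
Proof.
apply/eqP; rewrite eq_le; apply/andP; split.
  apply: dual_norm_le => x x1.
  by rewrite [X in `|X|]/(a *: f x) normrZ ler_wpM2l// dual_norm_ub1.
have [->|a0] := eqVneq a 0.
  rewrite normr0 mul0r; apply: le_trans (dual_norm_ub1 _ (x := 0) _) => //.
  by rewrite normr0.
rewrite mulrC -ler_pdivlMr ?normr_gt0//; apply: dual_norm_le => x x1.
rewrite ler_pdivlMr ?normr_gt0// mulrC -normrZ.
exact: (@dual_norm_ub1 (a *: f)).
Qed.

Lemma dual_norm_eq0 (f : dual) : dual_norm_on setT f = 0 -> f = 0.
Proof.
move=> f0; apply: val_inj; apply/funext => x; apply/eqP.
by rewrite -normr_le0 (le_trans (dual_norm_ub f x))// f0 mul0r.
Qed.

HB.instance Definition _ := Lmodule_isNormed.Build R dual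
  dual_normD dual_normZ dual_norm_eq0.

End dual_space.
Arguments dual {R} V.

Section functional_analysis.
Context {R : realType}.

(* In the product Q x V, weak convergence is used componentwise. *)
Definition weak_cvg (X : normedModType R) (x_ : nat -> X) (x : X) : Prop :=
  forall phi : dual X, phi (x_ n) @[n --> \oo] --> phi x.

(* Operator norm with value +oo on unbounded maps. *)
Definition opnorm (X Y : normedModType R) (T : X -> Y) : \bar R :=
  ereal_sup [set `|T x|%:E | x in [set x | `|x| <= 1]].

(* The inner product of the dual of a Hilbert space, obtained from the dual
   norm by polarization. *)
Definition dual_inner (W : hilbertType R) (phi psi : dual W) : R :=
  (`|phi + psi| ^+ 2 - `|phi - psi| ^+ 2) / 4.

(* Hilbert space adjoint of K; the vector selected by xget exists by the Riesz
   theorem when K is linear and bounded, and it is unique. *)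
Definition adjoint (V W : hilbertType R) (K : V -> dual W) (phi : dual W) : V :=
  xget 0 [set x | forall v, inner v x = dual_inner (K v) phi].

Definition inverse (V W : hilbertType R) (K : V -> dual W) : dual W -> V :=
  'pinv_(fun=> 0) setT K.

Definition findim_subspace (X : lmodType R) (S : set X) : Prop :=
  exists n (e : 'I_n -> X),
    S = [set x | exists c : 'I_n -> R, x = \sum_i c i *: e i].

End functional_analysis.

Section setting.
Context {R : realType} {Q V G W : hilbertType R}.

(* Operators are total functions with an explicit domain; their values outside
   of the domain carry no information. *)
Record problem := Problem {
  opA : Q -> V -> dual W;
  domA : set (Q * V);
  opC : V -> G;
  domC : set V;
  rhs : dual W;
  obs : G;
  initq : Q;
  initu : V;
  rho : R }.

(* Spaces in which a step is posed, and the norm put on the state space. The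
   norms of Q and G and the operators are evaluated exactly: discrete and
   continuous quantities differ only by normV and by the dual norm on spW. *)
Record level := Level {
  spQ : set Q;
  spV : set V;
  spW : set W;
  normV : V -> R }.

Definition full_level : level :=
  Level setT setT setT (fun v => `|v|).

(* The norm of V_h is applied to u - u_0, where u_0 need not belong to V_h, so
   it is a norm on V. It need not be the norm of V, but it has to dominate it:
   I_{1,h} controls u_h only through this norm. The norm inherited from V,
   normV v = `|v|, is the basic instance. *)
Definition discrete_level (l : level) : Prop :=
  [/\ findim_subspace (spQ l), findim_subspace (spV l),
      findim_subspace (spW l) &
      [/\ forall a v, normV l (a *: v) = `|a| * normV l v,
          forall v w, normV l (v + w) <= normV l v + normV l w &
          forall v, `|v| <= normV l v]].

(* One run of the method, for a fixed noise level. The discrete iterates qh, uh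
   are indexed from 0, everything else by the step k >= 1. The pair qc k, uc k
   solves the undiscretized problem of step k, which starts from the discrete
   iterate k - 1. *)
Record run := Run {
  gdelta : G;
  beta : nat -> R;
  lev : nat -> level;
  qh : nat -> Q;
  uh : nat -> V;
  qc : nat -> Q;
  uc : nat -> V;
  eta1 : nat -> R;
  eta2 : nat -> R;
  eta3 : nat -> R;
  eta4 : nat -> R;
  rterm : nat -> R }.

Variable P : problem.

Definition dAq (q : Q) (u : V) : {linear Q -> dual W} :=
  'd (fun q' => opA P q' u) q.
Definition dAu (q : Q) (u : V) : {linear V -> dual W} :=
  'd (fun u' => opA P q u') u.
Definition dC (u : V) : {linear V -> G} := 'd (opC P) u.

(* Open ball for the Hilbert norm of Q x V, not for the max norm that the
   library puts on products. *)
Definition inball (x : Q * V) : Prop :=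
  `|x.1 - initq P| ^+ 2 + `|x.2 - initu P| ^+ 2 < rho P ^+ 2.

Definition solution (q : Q) (u : V) : Prop :=
  [/\ domA P (q, u), domC P u, opC P u = obs P & opA P q u = rhs P].

Definition I2 (gd : G) (uold u : V) : R :=
  `|dC uold (u - uold) + opC P uold - gd| ^+ 2.

Definition I1 (l : level) (gd : G) (uold : V) (q : Q) (u : V) (b : R) : R :=
  I2 gd uold u + b^-1 * (`|q - initq P| ^+ 2 + normV l (u - initu P) ^+ 2).

(* The common expression of I_3 and I_4, which differ by their argument only. *)
Definition I34 (vrho : R) (l : level) (gd : G) (q : Q) (u : V) : R :=
  `|opC P u - gd| ^+ 2 + vrho * dual_norm_on (spW l) (opA P q u - rhs P).

Definition lagrangian (l : level) (gd : G) (b : R) (qold : Q) (uold : V)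
    (q : Q) (u : V) (z : W) : R :=
  I1 l gd uold q u b +
  (rhs P - opA P qold uold - dAq qold uold (q - qold)
   - dAu qold uold (u - uold)) z.

(* (q, u, z) is a stationary point of the Lagrangian on spQ l x spV l x spW l,
   i.e. (q, u) is a KKT point with multiplier z. *)
Definition stationary (l : level) (gd : G) (b : R) (qold : Q) (uold : V)
    (q : Q) (u : V) (z : W) : Prop :=
  let L := lagrangian l gd b qold uold in
  [/\ spQ l q, spV l u & spW l z] /\
  [/\ forall h, spQ l h -> is_derive q h (fun q' => L q' u z) 0,
      forall h, spV l h -> is_derive u h (fun u' => L q u' z) 0 &
      forall h, spW l h -> is_derive z h (fun z' => L q u z') 0].

Section one_run.
Variables (vrho : R) (X : run).

Definition qold k := qh X k.-1.
Definition uold k := uh X k.-1.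

Definition I1c k :=
  I1 full_level (gdelta X) (uold k) (qc X k) (uc X k) (beta X k).
Definition I2c k := I2 (gdelta X) (uold k) (uc X k).
Definition I3c k := I34 vrho full_level (gdelta X) (qold k) (uold k).
Definition I4c k := I34 vrho full_level (gdelta X) (qc X k) (uc X k).

Definition I1h k :=
  I1 (lev X k) (gdelta X) (uold k) (qh X k) (uh X k) (beta X k).
Definition I2h k := I2 (gdelta X) (uold k) (uh X k).
Definition I3h k := I34 vrho (lev X k) (gdelta X) (qold k) (uold k).
Definition I4h k := I34 vrho (lev X k) (gdelta X) (qh X k) (uh X k).

Definition iteration (delta : R) : Prop :=
  [/\ `|obs P - gdelta X| <= delta, qh X 0%N = initq P, uh X 0%N = initu P &
  forall k, (0 < k)%N ->
    [/\ 0 < beta X k, discrete_level (lev X k),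
        exists z, stationary (lev X k) (gdelta X) (beta X k)
                    (qold k) (uold k) (qh X k) (uh X k) z &
        exists z, stationary full_level (gdelta X) (beta X k)
                    (qold k) (uold k) (qc X k) (uc X k) z]].

Definition adjoint_bound (cadj : R) : Prop :=
  forall k l q u z, (0 < k)%N -> l = full_level \/ l = lev X k ->
    inball (qold k, uold k) ->
    stationary l (gdelta X) (beta X k) (qold k) (uold k) q u z ->
    `|z| <= cadj * (`|qold k - initq P| + `|uold k - initu P| + 1).

Definition discretization_accuracy (ctc tau tlo thi c1 c2 c3 : R) : Prop :=
  [/\ forall k, (0 < k)%N ->
        [/\ `|I1h k - I1c k| <= eta1 X k, `|I2h k - I2c k| <= eta2 X k,
            `|I3h k - I3c k| <= eta3 X k & `|I4h k - I4c k| <= eta4 X k],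
      forall k, (0 < k)%N ->
        eta1 X k + 4 * ctc ^+ 2 * eta3 X k <=
          (tlo - 2 * (2 * ctc ^+ 2 + (1 + 2 * ctc) ^+ 2 / tau ^+ 2)) * I3h k
        /\ eta3 X k <= c1 * I3h k,
      [/\ eta2 X @ \oo --> 0, eta3 X @ \oo --> 0 & eta4 X @ \oo --> 0],
      (forall k, (1 < k)%N -> I3h k <= (1 + c3) * I4h k.-1 + rterm X k)
        /\ rterm X @ \oo --> 0 &
      (1 + c3) * ((2 * thi + 4 * ctc ^+ 2) / (1 - 4 * ctc ^+ 2)) <= c2 < 1].

(* The iterate (qh k, uh k) satisfies the discrepancy principle. It is the old
   iterate of step k.+1, whence the shift of the index. *)
Definition discrepancy (tau delta : R) (k : nat) : Prop :=
  I3h k.+1 <= tau ^+ 2 * delta ^+ 2.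

Definition stopping_index (tau delta : R) (k : nat) : Prop :=
  discrepancy tau delta k /\
  forall j, (j < k)%N -> ~ discrepancy tau delta j.

End one_run.

Definition has_derivatives : Prop :=
  forall q u, inball (q, u) ->
    [/\ differentiable (fun q' => opA P q' u) q,
        differentiable (fun u' => opA P q u') u & differentiable (opC P) u].

Definition exact_solution (qd : Q) (ud : V) : Prop :=
  [/\ inball (qd, ud), solution qd ud &
      inball `<=` [set x | domA P x /\ domC P x.2]].

(* Stability of the equation: solutions for perturbed right-hand sides stay
   close to u. Stability of the linearization: bounded inverse. *)
Definition well_posed : Prop :=
  (forall q, `|q - initq P| < rho P -> exists u,
     [/\ domA P (q, u), opA P q u = rhs P,
         forall u', domA P (q, u') -> opA P q u' = rhs P -> u' = u &
         forall e, 0 < e -> exists2 d, 0 < d &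
           forall u', domA P (q, u') -> `|opA P q u' - rhs P| <= d ->
             `|u' - u| <= e]) /\
  (forall q u, inball (q, u) ->
     bijective (dAu q u) /\
     exists M, forall v, `|v| <= M * `|dAu q u v|).

Definition continuous_weakly_closed : Prop :=
  {within [set x | domA P x /\ domC P x.2],
    continuous (fun x : Q * V => (opC P x.2, opA P x.1 x.2))} /\
  forall (q_ : nat -> Q) (u_ : nat -> V) q u (g : G) (f : dual W),
    (forall n, domA P (q_ n, u_ n) /\ domC P (u_ n)) ->
    weak_cvg q_ q -> weak_cvg u_ u ->
    opC P (u_ n) @[n --> \oo] --> g ->
    opA P (q_ n) (u_ n) @[n --> \oo] --> f ->
    [/\ domC P u, domA P (q, u), opC P u = g & opA P q u = f].

Definition tangential_cone (ctc : R) : Prop :=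
  forall q u q' u', inball (q, u) -> inball (q', u') ->
    `|opC P u - opC P u' - dC u (u - u')| <= ctc * `|opC P u - opC P u'| /\
    `|opA P q u - opA P q' u' - dAq q u (q - q') - dAu q u (u - u')|
      <= 4 * ctc ^+ 2 * `|opA P q u - opA P q' u'|.

Definition uniform_bounds : Prop :=
  (ereal_sup
    [set `|opA P x.1 x.2|%:E + opnorm (dAq x.1 x.2)
         + opnorm (adjoint (dAu x.1 x.2))
         + opnorm (inverse (dAu x.1 x.2)) | x in inball] < +oo)%E /\
  (ereal_sup
    [set `|opC P u|%:E + opnorm (dC u) | u in ball (initu P) (rho P)] < +oo)%E.

End setting.
Arguments problem {R} Q V G W.
Arguments run {R} Q V G W.

Definition parameter_bounds (R : realType) (ctc tau tlo thi : R) : Prop :=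
  2 * (ctc ^+ 2 + (1 + ctc) ^+ 2 / tau ^+ 2) < tlo /\
  (2 * thi + 4 * ctc ^+ 2) / (1 - 4 * ctc ^+ 2) < 1.

(* Main.v *)
Require Import Defs.
From HB Require Import structures.
From mathcomp Require Import all_boot all_order all_algebra.
From mathcomp Require Import ring lra.
From mathcomp Require Import all_classical all_reals all_analysis.

Set Implicit Arguments.
Unset Strict Implicit.
Unset Printing Implicit Defensive.
Import Order.TTheory GRing.Theory Num.Theory.
Import numFieldNormedType.Exports.
Local Open Scope classical_set_scope.
Local Open Scope ring_scope.

(* Convexity makes the continuous iterate a minimiser of the Lagrangian, so its
   value is at most that at any solution s of F(q,u) = g in the ball. The
   tangential cone condition bounds the latter by
   |s - (q0,u0)|^2 / beta plus a small multiple of I_3 + delta^2, and the lower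
   bound I_2 >= tlo I_3 absorbs the remainder: this gives (i), with every
   solution in the ball in place of the exact one. Bounds on the old iterate
   only give |z| <= 2 varrho, since |q| + |u| is not monotone in |q|^2 + |u|^2;
   the extra factor is paid for by ctc being small relative to tau and c1.
   While the iteration has not stopped, eta_2 becomes small compared with
   delta^2, so the continuous iterates enter the ball as well, I_{3,h} contracts
   up to a null sequence, and (ii) follows. For (iii), a weak limit is a
   solution in the ball by weak closedness, and (i) with that solution bounds
   the norms by that of the weak limit, whence strong convergence. *)

(** * Inner product geometry and Riesz representation *)

Section hilbert.
Context {R : realType} {H : hilbertType R}.
Implicit Types (x y z : H) (a : R) (S : set H).

Lemma innerDr x y z : inner x (y + z) = inner x y + inner x z.
Proof. by rewrite innerC innerDl !(innerC x). Qed.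

Lemma innerZr a x y : inner x (a *: y) = a * inner x y.
Proof. by rewrite innerC innerZl (innerC x). Qed.

Lemma innerNl x y : inner (- x) y = - inner x y.
Proof. by rewrite -scaleN1r innerZl mulN1r. Qed.

Lemma innerNr x y : inner x (- y) = - inner x y.
Proof. by rewrite innerC innerNl innerC. Qed.

Lemma inner0r x : inner x 0 = 0.
Proof. by rewrite -(scale0r 0) innerZr mul0r. Qed.

Lemma normD_sqr x y : `|x + y| ^+ 2 = `|x| ^+ 2 + 2 * inner x y + `|y| ^+ 2.
Proof. rewrite -!inner_norm innerDl !innerDr (innerC y x); ring. Qed.

Lemma normB_sqr x y : `|x - y| ^+ 2 = `|x| ^+ 2 - 2 * inner x y + `|y| ^+ 2.
Proof. by rewrite normD_sqr normrN innerNr mulrN. Qed.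

Lemma cauchy_schwarz x y : `|inner x y| <= `|x| * `|y|.
Proof.
have [->|y0] := eqVneq y 0.
  by rewrite inner0r !normr0 mulr0.
rewrite -ler_sqr ?nnegrE ?mulr_ge0// real_normK ?num_real// exprMn.
have yy : 0 < `|y| ^+ 2 by rewrite exprn_gt0// normr_gt0.
have : 0 <= `|x - (inner x y / `|y| ^+ 2) *: y| ^+ 2 by rewrite exprn_ge0.
rewrite normB_sqr innerZr normrZ exprMn real_normK ?num_real//.
set X := `|x| ^+ 2; set Y := `|y| ^+ 2 in yy *; set i := inner x y.
move=> h; have := mulr_ge0 h (ltW yy).
have -> : (X - 2 * (i / Y * i) + (i / Y) ^+ 2 * Y) * Y = X * Y - i ^+ 2.
  by field; rewrite gt_eqF.
by rewrite subr_ge0.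
Qed.

Lemma parallelogram_half x y :
  `|2^-1 *: (x + y)| ^+ 2 =
    2^-1 * (`|x| ^+ 2 + `|y| ^+ 2) - 4^-1 * `|x - y| ^+ 2.
Proof.
rewrite normrZ exprMn normfV ger0_norm// normB_sqr normD_sqr.
by field.
Qed.

(** For small [t] the linear term dominates; [t = s] and [t = - s] bound [l] from below and above,
    with [s] chosen so that [s * m <= e]. *)
Lemma quadratic_ge0_linear0 (l m : R) :
  (forall t, 0 <= t * l + t ^+ 2 * m) -> l = 0.
Proof.
move=> h; apply/eqP; rewrite -normr_le0; apply/ler_addgt0Pr => e e0.
rewrite add0r.
pose s := e / (`|m| + 1).
have m1 : 0 < `|m| + 1 by rewrite ltr_wpDl.
have s0 : 0 < s by rewrite divr_gt0.
have sm : s * m <= e.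
  have -> : e = s * (`|m| + 1) by rewrite /s divfK// gt_eqF.
  by rewrite ler_pM2l// (le_trans (ler_norm _))// lerDl.
have E t : t * l + t ^+ 2 * m = t * (l + t * m) by ring.
have := h s; have := h (- s); rewrite !E mulNr -mulrN !pmulr_rge0// => h1 h2.
by rewrite ler_norml; apply/andP; split; lra.
Qed.

(* Minimise the strictly convex functional |x|^2 - 2 phi x over S; its sublevel
   sets form a Cauchy filter by the parallelogram identity. *)
Lemma riesz_on (S : set H) (phi : H -> R) (M : R) :
  S 0 -> (forall x y, S x -> S y -> S (x + y)) ->
  (forall a x, S x -> S (a *: x)) -> closed S ->
  (forall x y, phi (x + y) = phi x + phi y) ->
  (forall a x, phi (a *: x) = a * phi x) ->
  (forall x, `|phi x| <= M * `|x|) ->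
  exists2 p, S p & forall s, S s -> inner p s = phi s.
Proof.
move=> S0 SD SZ Scl pD pZ pM.
pose J x := `|x| ^+ 2 - 2 * phi x.
have Jlb x : - M ^+ 2 <= J x.
  have := pM x; rewrite ler_norml => /andP[_ h].
  have : 0 <= (`|x| - M) ^+ 2 by rewrite sqr_ge0.
  by rewrite /J; nra.
pose E := J @` S.
have Einf : has_inf E.
  split; first by exists (J 0), 0.
  by exists (- M ^+ 2) => _ [x _ <-].
pose d := inf E.
have Jd x : S x -> d <= J x by move=> Sx; apply: (ge_inf Einf.2); exists x.
pose B (e : R) := [set x | S x /\ J x < d + e].
have B0 e : 0 < e -> B e !=set0.
  move=> e0; have [_ [x Sx <-] h] := inf_adherent e0 Einf.
  by exists x.
have Bsmall e x y : B e x -> B e y -> `|x - y| ^+ 2 <= 4 * e.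
  move=> [Sx Jx] [Sy Jy].
  have := Jd _ (SZ 2^-1 _ (SD _ _ Sx Sy)).
  rewrite /J parallelogram_half pZ pD; move: Jx Jy; rewrite /J => *; lra.
pose F := filter_from [set e : R | 0 < e] B.
have FF : ProperFilter F.
  apply: filter_from_proper; last by move=> e /B0.
  apply: filter_from_filter; first by exists 1 => /=.
  move=> e1 e2 /= e10 e20; exists (Num.min e1 e2).
    by rewrite /= lt_min e10.
  move=> x [Sx Jx]; split; split=> //; apply: (lt_le_trans Jx).
    by rewrite lerD2l ge_min lexx.
  by rewrite lerD2l ge_min lexx orbT.
have cF : cauchy F.
  apply/cauchy_exP => e e0.
  (* With this radius [Bsmall] bounds squared distances by [e ^+ 2 / 2]. *)
  have e2 : 0 < e ^+ 2 / 8 by rewrite divr_gt0// exprn_gt0.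
  have [x Bx] := B0 _ e2; exists x; exists (e ^+ 2 / 8) => //= y By.
  rewrite -ball_normE /=.
  have := Bsmall _ _ _ Bx By => h.
  rewrite -(@ltr_pXn2r _ 2) ?nnegrE// ?(ltW e0)//; apply: le_lt_trans h _.
  have : 0 < e ^+ 2 by rewrite exprn_gt0.
  lra.
have Fcvg : F --> lim F by apply: cauchy_cvg.
set p := lim F in Fcvg.
have Sp : S p.
  apply: (@closed_cvg _ _ F _ id S Scl _ p Fcvg).
  by exists 1 => //= x [].
have phic x : {for x, continuous phi}.
  apply/cvgrPdist_lt => e e0.
  have M1 : 0 < `|M| + 1 by rewrite ltr_wpDl.
  near=> y.
  have -> : phi x - phi y = phi (x - y) by rewrite pD -(scaleN1r y) pZ mulN1r.
  apply: le_lt_trans (pM _) _.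
  apply: (@le_lt_trans _ _ ((`|M| + 1) * `|x - y|)).
    by rewrite ler_wpM2r// (le_trans (ler_norm _))// lerDl.
  rewrite mulrC -ltr_pdivlMr//; near: y.
  by apply: cvgr_dist_lt; rewrite ?divr_gt0//; exact: cvg_id.
have Jp : J p <= d.
  apply/ler_addgt0Pr => e e0.
  have Jc : J @ F --> J p.
    apply: cvgB; first by apply: cvgM; apply: cvg_norm; exact: Fcvg.
    by apply: cvgM; [exact: cvg_cst|exact: (cvg_comp _ _ Fcvg (phic p))].
  apply: (cvgr_to_le Jc); exists e => //= x [_ Jx]; exact: ltW.
exists p => // s Ss; apply/eqP; rewrite -subr_eq0; apply/eqP.
(* Half of [J (p + t *: s) - J p] is [t * (inner p s - phi s)] plus [t ^+ 2] times this coefficient,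
   and it is nonnegative because [p] minimises [J] over [S]. *)
apply: (@quadratic_ge0_linear0 _ (2^-1 * `|s| ^+ 2)) => t.
have := le_trans Jp (Jd _ (SD _ _ Sp (SZ t _ Ss))).
rewrite /J normD_sqr innerZr pD pZ normrZ exprMn real_normK ?num_real//.
by lra.
Unshelve. all: by end_near. Qed.

Lemma riesz (phi : dual H) : exists y, forall x, phi x = inner x y.
Proof.
have phiZ a x : phi (a *: x) = a * phi x by rewrite linearZ.
have [p _ pE] := @riesz_on setT phi _ I (fun _ _ _ _ => I) (fun _ _ _ => I)
  closedT (linearD phi) phiZ (dual_norm_ub phi).
by exists p => x; rewrite innerC pE.
Qed.

(** * Weak convergence and weak sequential compactness *)

Lemma inner_continuous y : continuous (inner^~ y : H -> R^o).
Proof.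
move=> x; apply/cvgrPdist_lt => e e0.
have y1 : 0 < `|y| + 1 by rewrite ltr_wpDl.
near=> z.
rewrite -innerNl -innerDl; apply: le_lt_trans (cauchy_schwarz _ _) _.
apply: (@le_lt_trans _ _ (`|x - z| * (`|y| + 1))).
  by rewrite ler_wpM2l// lerDl.
rewrite -ltr_pdivlMr//; near: z.
by apply: cvgr_dist_lt; rewrite ?divr_gt0//; exact: cvg_id.
Unshelve. all: by end_near. Qed.

Lemma inner_in_dual y : (inner^~ y : H -> R^o) \in @dual_pred R H.
Proof.
apply/mem_set; split; last exact: inner_continuous.
by move=> a u v; rewrite innerDl innerZl.
Qed.

Lemma weak_cvgP (x_ : nat -> H) x :
  weak_cvg x_ x <-> forall y, inner (x_ n) y @[n --> \oo] --> inner x y.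
Proof.
split=> [h y|h phi]; first exact: (h (Dual (inner_in_dual y))).
have [y phiE] := riesz phi.
have -> : (fun n => phi (x_ n)) = (fun n => inner (x_ n) y).
  by apply/funext => n; rewrite phiE.
by rewrite phiE; exact: h.
Qed.

(** Compactness of the segment gives a cluster point, and a cluster point of an ultrafilter is a
    limit: the preimage of a neighbourhood or its complement belongs to [U], and the latter is
    excluded. *)
Lemma ultra_bounded_cvg (U : set_system nat) (u : nat -> R) (M : R) :
  UltraFilter U -> (forall n, `|u n| <= M) -> exists l : R, u @ U --> l.
Proof.
move=> UU uM; have UP : ProperFilter U by exact: ultra_proper.
have [|l [_ ul]] := @segment_compact _ (- M) M (u @ U) _.
  by apply: nearW => n; rewrite /= in_itv /= -ler_norml.
exists l => B lB; have [//|UBc] := in_ultra_setVsetC (u @^-1` B) UU.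
by have [z []] := ul (~` B) B UBc lB.
Qed.

(* Riesz represents the ultrafilter limit of the functionals inner (x_ n) by
   some x. A subsequence is chosen along which the products with the countably
   many vectors x_ m converge to those with x; a vector orthogonal to all x_ m
   is orthogonal to x, so that the other directions do not matter. *)
Lemma bounded_weak_subseq (x_ : nat -> H) (M : R) : (forall n, `|x_ n| <= M) ->
  exists phi : nat -> nat, {homo phi : m n / (m < n)%N} /\
    exists x, weak_cvg (x_ \o phi) x.
Proof.
move=> xM.
have [U [UU sU]] := @ultraFilterLemma nat \oo _.
have UP : ProperFilter U by exact: ultra_proper.
have xb y n : `|inner (x_ n) y| <= M * `|y|.
  by rewrite (le_trans (cauchy_schwarz _ _))// ler_wpM2r.
have /choice[L LE] : forall y, exists l : R, inner (x_ n) y @[n --> U] --> l.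
  by move=> y; apply: ultra_bounded_cvg (xb y).
have LU y (l : R) : inner (x_ n) y @[n --> U] --> l -> L y = l.
  by move=> h; apply: (cvg_unique _ (LE y) h).
have LD y z : L (y + z) = L y + L z.
  apply: LU; under eq_fun do rewrite innerDr.
  exact: cvgD (LE y) (LE z).
have LZ a y : L (a *: y) = a * L y.
  apply: LU; under eq_fun do rewrite innerZr.
  exact: cvgM (cvg_cst _) (LE y).
have Lb y : `|L y| <= M * `|y|.
  have h : `|inner (x_ n) y| @[n --> U] --> `|L y| by exact: cvg_norm (LE y).
  by apply: (cvgr_to_le h); apply: nearW.
have [x _ xE] := @riesz_on setT L M I (fun _ _ _ _ => I) (fun _ _ _ => I)
  closedT LD LZ Lb.
(* Each [A N] belongs to [U] and so meets every tail, since [U] refines [\oo]; [phi] picks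
   increasing indices from these sets. *)
pose A N :=
  [set n | forall m : 'I_N.+1, `|inner (x_ n - x) (x_ m)| < N.+1%:R^-1].
have AU N : U (A N).
  apply: filter_forall => m; near=> n.
  rewrite innerDl innerNl xE// distrC; near: n.
  by apply: cvgr_dist_lt (LE (x_ m)) _ _; rewrite invr_gt0.
have /choice[next nextP] : forall Nk : nat * nat, exists n,
    (Nk.2 < n)%N /\ A Nk.1 n.
  move=> [N k]; apply: (@filter_ex _ U); apply: filterI; last exact: AU.
  by apply: sU; exists k.+1.
pose phi := fix phi N := next (N, if N is N'.+1 then phi N' else 0%N).
have phiA N : A N (phi N).
  case: N => [|N]; [by have [] := nextP (0, 0)%N|].
  by have [] := nextP (N.+1, phi N).
have phiS N : (phi N < phi N.+1)%N by have [] := nextP (N.+1, phi N).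
exists phi; split; first by apply: homo_ltn phiS; exact: ltn_trans.
exists x; apply/weak_cvgP.
pose w n := x_ (phi n) - x.
have wM n : `|w n| <= M + `|x|.
  by rewrite (le_trans (ler_normB _ _))// lerD2r.
pose Y := [set y | inner (w n) y @[n --> \oo] --> (0 : R)].
have Yx m : Y (x_ m).
  apply/cvgrPdist_lt => e e0; near=> n; rewrite sub0r normrN.
  have mn : (m < n.+1)%N by near: n; exists m.
  apply: lt_trans (phiA n (Ordinal mn)) _.
  by near: n; exact: (near_infty_natSinv_lt (PosNum e0)).
have Y0 : Y 0.
  by rewrite /Y /=; under eq_fun do rewrite inner0r; exact: cvg_cst.
have YD y z : Y y -> Y z -> Y (y + z).
  rewrite /Y /= => h1 h2; under eq_fun do rewrite innerDr.
  by rewrite -[0]addr0; exact: cvgD.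
have YZ a y : Y y -> Y (a *: y).
  rewrite /Y /= => h1; under eq_fun do rewrite innerZr.
  by rewrite -(mulr0 a); apply: cvgM h1; exact: cvg_cst.
have Ycl : closed Y.
  move=> y cy; apply/cvgrPdist_lt => e e0.
  have C0 : 0 < M + `|x| + 1 by rewrite ltr_wpDl// (le_trans _ (wM 0%N)).
  have d0 : 0 < e / 2 / (M + `|x| + 1) by rewrite !divr_gt0.
  have [z [Yz]] := cy _ (nbhsx_ballx y _ d0); rewrite -ball_normE /= => yz.
  near=> n; rewrite sub0r normrN -(subrK z y) innerDr [e]splitr.
  apply: le_lt_trans (ler_normD _ _) _; apply: ltrD.
    apply: le_lt_trans (cauchy_schwarz _ _) _.
    apply: (@le_lt_trans _ _ ((M + `|x| + 1) * `|y - z|)).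
      by rewrite ler_wpM2r// (le_trans (wM n))// lerDl.
    by rewrite mulrC -ltr_pdivlMr.
  rewrite -normrN -sub0r; near: n.
  by apply: cvgr_dist_lt; rewrite ?divr_gt0.
suff YT y : Y y.
  move=> y; rewrite -[inner x y]add0r.
  have -> : (fun n => inner ((x_ \o phi) n) y) =
      (fun n => inner (w n) y + inner x y).
    by apply/funext => n /=; rewrite /w innerDl innerNl subrK.
  by apply: cvgD (YT y) _; exact: cvg_cst.
(* [p] is the orthogonal projection of [y] on [Y]: it represents the functional [inner y] on that
   closed subspace. Hence [y - p] is orthogonal to every [x_ m], and then to [x]. *)
have [p Yp pE] := @riesz_on Y (inner y) `|y| Y0 YD YZ Ycl (innerDr y)
  (fun a => innerZr a y) (cauchy_schwarz y).
have xo m : inner (x_ m) (y - p) = 0.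
  by rewrite innerC innerDl innerNl pE// subrr.
have xo' : inner x (y - p) = 0.
  rewrite xE//; apply: LU; under eq_fun do rewrite xo; exact: cvg_cst.
rewrite /Y /= -(subrK p y).
under eq_fun do rewrite innerDr /w innerDl innerNl xo xo' subrr add0r.
exact: Yp.
Unshelve. all: by end_near. Qed.

(** Testing with the shifted limit itself gives the mixed term in the expansion of the squared
    distance of [x_ n] to [x] around [x0]. *)
Lemma inner_weak_lim (x_ : nat -> H) x x0 : weak_cvg x_ x ->
  inner (x_ n - x0) (x - x0) @[n --> \oo] --> `|x - x0| ^+ 2.
Proof.
move=> /weak_cvgP/(_ (x - x0)) h; rewrite -inner_norm innerDl innerNl.
under eq_fun do rewrite innerDl innerNl.
by apply: cvgB h _; exact: cvg_cst.
Qed.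

End hilbert.

(** * Directional derivatives of quadratics, and evaluation in the dual *)

(** Along a line the Lagrangian is a polynomial of degree at most two, so its derivative is read off
    as a coefficient: the difference quotient is [l + h * m]. *)
Lemma is_derive_quadratic (R : realType) (X : normedModType R) (f : X -> R)
    (a v : X) (l m df : R) :
  (forall t, f (t *: v + a) = f a + t * l + t ^+ 2 * m) ->
  is_derive a v f df -> df = l.
Proof.
move=> fE [_ <-]; rewrite /derive; apply/cvg_lim => //.
have lm : l + h * m @[h --> 0^'] --> l + 0 * m.
  apply: cvgD; first exact: cvg_cst.
  by apply: cvgM; [exact: nbhs_dnbhs|exact: cvg_cst].
rewrite mul0r addr0 in lm.
apply: cvg_trans lm; apply: near_eq_cvg; near=> h.
have h0 : h != 0 by near: h; exact: nbhs_dnbhs_neq.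
rewrite /= fE /GRing.scale /=; field; exact: h0.
Unshelve. all: by end_near. Qed.

Lemma dual_normE (R : realType) (X : normedModType R) (f : dual X) :
  dual_norm_on setT f = `|f|.
Proof. by []. Qed.

Lemma dualDE (R : realType) (X : normedModType R) (f g : dual X) x :
  (f + g) x = f x + g x.
Proof. by []. Qed.

Lemma dualNE (R : realType) (X : normedModType R) (f : dual X) x :
  (- f) x = - f x.
Proof. by []. Qed.

Lemma dualZE (R : realType) (X : normedModType R) a (f : dual X) x :
  (a *: f) x = a * f x.
Proof. by []. Qed.

Lemma dual0E (R : realType) (X : normedModType R) x : (0 : dual X) x = 0.
Proof. by []. Qed.

Lemma sqr_leD2 (R : realFieldType) (x a b : R) : 0 <= x -> x <= a + b ->
  x ^+ 2 <= 2 * a ^+ 2 + 2 * b ^+ 2.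
Proof.
move=> x0 xab; have : x ^+ 2 <= (a + b) ^+ 2.
  by rewrite ler_pXn2r ?nnegrE// (le_trans x0).
have := sqr_ge0 (a - b); nra.
Qed.

(** * The continuous Gauss-Newton step under the tangential cone condition *)

Section gauss_newton_step.
Context {R : realType} {Q V G W : hilbertType R}.
Variable P : problem Q V G W.
Implicit Types (q : Q) (u : V) (z : W) (gd : G) (b : R).

Definition dist0 q u : R := `|q - initq P| ^+ 2 + `|u - initu P| ^+ 2.

(** Residual of the linearised state equation, written exactly as in [lagrangian] so that it can be
    folded there. *)
Definition lin_residual (qo : Q) (uo : V) q u : dual W :=
  rhs P - opA P qo uo - dAq P qo uo (q - qo) - dAu P qo uo (u - uo).

Lemma lin_residual_shift qo uo q u dq du z :
  lin_residual qo uo (dq + q) (du + u) z =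
  lin_residual qo uo q u z - dAq P qo uo dq z - dAu P qo uo du z.
Proof.
rewrite /lin_residual -(addrA dq) -(addrA du).
have -> : dAq P qo uo (dq + (q - qo)) = dAq P qo uo dq + dAq P qo uo (q - qo).
  by rewrite linearD.
have -> : dAu P qo uo (du + (u - uo)) = dAu P qo uo du + dAu P qo uo (u - uo).
  by rewrite linearD.
by rewrite !(dualDE, dualNE); ring.
Qed.

(** Exact Taylor expansion of a quadratic functional: the two middle brackets are the partial
    derivatives in the directions [dq] and [du], the last one is the second order term. Stationarity
    and minimality are both read off from it. *)
Lemma lagrangian_shift gd b qo uo q u z dq du :
  lagrangian P full_level gd b qo uo (dq + q) (du + u) z =
  lagrangian P full_level gd b qo uo q u z +
  (2 * b^-1 * inner (q - initq P) dq - dAq P qo uo dq z) +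
  (2 * inner (dC P uo (u - uo) + opC P uo - gd) (dC P uo du) +
   2 * b^-1 * inner (u - initu P) du - dAu P qo uo du z) +
  (`|dC P uo du| ^+ 2 + b^-1 * (`|dq| ^+ 2 + `|du| ^+ 2)).
Proof.
rewrite /lagrangian -!/(lin_residual _ _ _ _) lin_residual_shift /I1 /I2 /=.
rewrite -(addrA dq _ (- initq P)) (addrC dq) -(addrA du _ (- initu P)).
rewrite (addrC du (u - initu P)).
have -> : dC P uo (du + u - uo) + opC P uo - gd =
  dC P uo (u - uo) + opC P uo - gd + dC P uo du.
  by rewrite -(addrA du) linearD /= -!addrA addrC !addrA.
by rewrite !normD_sqr; ring.
Qed.

(** On the full spaces all directions are admissible, so each coefficient of the expansion vanishes.
    In [z] the Lagrangian is affine, and its slope is the residual of the constraint. *)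
Lemma stationary_full gd b qo uo q u z :
  stationary P full_level gd b qo uo q u z ->
  [/\ forall dq, 2 * b^-1 * inner (q - initq P) dq - dAq P qo uo dq z = 0,
      forall du, 2 * inner (dC P uo (u - uo) + opC P uo - gd) (dC P uo du) +
        2 * b^-1 * inner (u - initu P) du - dAu P qo uo du z = 0 &
      lin_residual qo uo q u = 0].
Proof.
move=> [_ [dLq dLu dLz]]; split.
- move=> dq; apply/esym.
  apply: (is_derive_quadratic (m := b^-1 * `|dq| ^+ 2)) (dLq dq I) => t.
  rewrite -[in LHS](add0r u) lagrangian_shift /= !inner0r normrZ exprMn.
  have -> : dAq P qo uo (t *: dq) = t *: dAq P qo uo dq by rewrite linearZ.
  rewrite real_normK ?num_real// innerZr !linear0 inner0r !normr0 !dualZE.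
  by ring.
- move=> du; apply/esym.
  apply: (is_derive_quadratic (m := `|dC P uo du| ^+ 2 + b^-1 * `|du| ^+ 2))
    (dLu du I) => t.
  rewrite -[in LHS](add0r q) lagrangian_shift /= !inner0r.
  have -> : dAu P qo uo (t *: du) = t *: dAu P qo uo du by rewrite linearZ.
  have -> : dC P uo (t *: du) = t *: dC P uo du by rewrite linearZ.
  rewrite !normrZ !exprMn real_normK ?num_real// !innerZr !linear0 !normr0.
  by rewrite !dualZE; ring.
- apply: val_inj; apply/funext => h; apply/esym.
  apply: (is_derive_quadratic (m := 0)) (dLz h I) => t.
  rewrite /lagrangian -!/(lin_residual _ _ _ _).
  have -> : lin_residual qo uo q u (t *: h + z) =
      t * lin_residual qo uo q u h + lin_residual qo uo q u z.
    by rewrite linearD linearZ.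
  by ring.
Qed.

(** The first order terms vanish and the second order term is nonnegative. The competitor [(q', u')]
    may violate the linearised constraint; the multiplier term accounts for the violation. *)
Lemma stationary_le gd b qo uo q u z q' u' : 0 < b ->
  stationary P full_level gd b qo uo q u z ->
  lagrangian P full_level gd b qo uo q u z <=
  lagrangian P full_level gd b qo uo q' u' z.
Proof.
move=> b0 /stationary_full[dLq dLu _].
rewrite -(subrK q q') -(subrK u u') lagrangian_shift dLq dLu !addr0 lerDl.
apply: addr_ge0; first exact: sqr_ge0.
by rewrite mulr_ge0 ?invr_ge0 ?(ltW b0)//; apply: addr_ge0; exact: sqr_ge0.
Qed.

Lemma lagrangian_stationary gd b qo uo q u z :
  stationary P full_level gd b qo uo q u z ->
  lagrangian P full_level gd b qo uo q u z = I1 P full_level gd uo q u b.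
Proof.
move=> /stationary_full[_ _ h].
by rewrite /lagrangian -!/(lin_residual _ _ _ _) h dual0E addr0.
Qed.

Variables (ctc : R) (vrho : R).
Hypotheses (ctc_ge0 : 0 <= ctc) (cone : tangential_cone P ctc)
  (vrho_ge0 : 0 <= vrho).

(** The competitor is the solution [(qs, us)]. The cone condition for [opC] and the noise level
    bound its linearised misfit; the one for [opA] bounds its violation of the linearised equation,
    where pairing with [z], of norm at most [2 * vrho], turns the factor 4 into 8. *)
Lemma I1_stationary_le gd b delta qo uo q u z qs us : 0 < b ->
  stationary P full_level gd b qo uo q u z ->
  inball P (qo, uo) -> inball P (qs, us) -> solution P qs us ->
  `|obs P - gd| <= delta -> `|z| <= 2 * vrho ->
  I1 P full_level gd uo q u b <= b^-1 * dist0 qs us +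
    2 * ctc ^+ 2 * `|opC P uo - gd| ^+ 2 + 2 * (1 + ctc) ^+ 2 * delta ^+ 2 +
    8 * ctc ^+ 2 * (vrho * `|opA P qo uo - rhs P|).
Proof.
move=> b0 st bo bs [_ _ Cs As] gdE zr.
rewrite -(lagrangian_stationary st).
apply: le_trans (stationary_le qs us b0 st) _.
have [hC hA] := cone bo bs; rewrite Cs As in hC hA.
rewrite /lagrangian -!/(lin_residual _ _ _ _) /I1 /= -/(dist0 qs us).
have h2 : I2 P gd uo us <=
    2 * ctc ^+ 2 * `|opC P uo - gd| ^+ 2 + 2 * (1 + ctc) ^+ 2 * delta ^+ 2.
  have e1 : `|opC P uo - obs P| <= `|opC P uo - gd| + delta.
    have -> : opC P uo - obs P = opC P uo - gd - (obs P - gd).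
      by rewrite opprB addrA subrK.
    by rewrite (le_trans (ler_normB _ _))// lerD2l.
  have e2 : `|dC P uo (us - uo) + opC P uo - gd| <=
      ctc * `|opC P uo - gd| + (1 + ctc) * delta.
    have -> : dC P uo (us - uo) + opC P uo - gd =
        (opC P uo - obs P - dC P uo (uo - us)) + (obs P - gd).
      rewrite -(opprB us uo) linearN opprK (addrAC (opC P uo)) addrA subrK.
      by rewrite [X in X - gd]addrC.
    apply: le_trans (ler_normD _ _) _.
    by have := ler_wpM2l ctc_ge0 e1; lra.
  rewrite /I2; apply: (le_trans (sqr_leD2 _ e2)) => //.
  by rewrite !exprMn; lra.
have h3 : lin_residual qo uo qs us z <=
    8 * ctc ^+ 2 * (vrho * `|opA P qo uo - rhs P|).
  have e1 : `|lin_residual qo uo qs us| <=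
      4 * ctc ^+ 2 * `|opA P qo uo - rhs P|.
    rewrite -normrN; apply: le_trans hA; rewrite le_eqVlt; apply/orP; left.
    apply/eqP; congr (`|_|); rewrite /lin_residual.
    rewrite -(opprB qs qo) -(opprB us uo) !linearN !opprK -!addrA.
    by rewrite !opprD !opprK !addrA (addrC (opA P qo uo)).
  apply: le_trans (ler_norm _) _; apply: le_trans (dual_norm_ub _ _) _.
  apply: (@le_trans _ _ (4 * ctc ^+ 2 * `|opA P qo uo - rhs P| * (2 * vrho))).
    by apply: ler_pM => //; exact: (normr_ge0 (lin_residual qo uo qs us)).
  by rewrite le_eqVlt; apply/orP; left; apply/eqP; ring.
by lra.
Qed.

(** The cone condition compares linearised and nonlinear residuals, and the part at [(q, u)] is
    absorbed on the left. Squaring the condition for [opC] produces the factor [4 * ctc ^+ 2], the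
    very constant in the condition for [opA], so both summands of [I34] are absorbed alike. *)
Lemma I34_stationary_le gd b qo uo q u z : 4 * ctc ^+ 2 < 1 ->
  stationary P full_level gd b qo uo q u z ->
  inball P (qo, uo) -> inball P (q, u) ->
  (1 - 4 * ctc ^+ 2) * I34 P vrho full_level gd q u <=
    2 * I2 P gd uo u + 4 * ctc ^+ 2 * I34 P vrho full_level gd qo uo.
Proof.
move=> c1 /stationary_full[_ _ r0] bo bs; have [hC hA] := cone bo bs.
rewrite /I34 /I2 /= !dual_normE.
set x := `|opC P u - gd|; set a := `|opC P uo - gd|.
set ax := `|opA P q u - _|; set aa := `|opA P qo uo - rhs P|.
have hx : x <= `|dC P uo (u - uo) + opC P uo - gd| + ctc * (a + x).
  have xE : x = `|dC P uo (u - uo) + opC P uo - gd -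
      (opC P uo - opC P u - dC P uo (uo - u))|.
    rewrite /x; congr (`|_|).
    rewrite -(opprB u uo) linearN opprK opprD opprB [RHS]addrC.
    by rewrite -[dC _ _ _ + _ - _]addrA addrA subrK subrKA.
  rewrite {1}xE; apply: le_trans (ler_normB _ _) _.
  rewrite lerD2l (le_trans hC)// ler_wpM2l//.
  rewrite -(subrKA gd) /x (distrC (opC P u)).
  exact: ler_normD.
have hax : ax <= 4 * ctc ^+ 2 * (aa + ax).
  (* By [r0] the linearised equation holds, so the residual of [opA] at [(q, u)] is a pure
     linearisation error. *)
  have axE : ax = `|opA P qo uo - opA P q u - dAq P qo uo (qo - q)
      - dAu P qo uo (uo - u)|.
    rewrite /ax distrC; move/eqP: r0; rewrite /lin_residual !subr_eq add0r.
    move=> /eqP->; rewrite -(opprB q qo) -(opprB u uo) !linearN !opprK.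
    by rewrite (addrC (dAu _ _ _ _)) -[in RHS]addrA [in RHS]addrC [in RHS]addrA.
  rewrite {1}axE; apply: le_trans hA _; rewrite ler_wpM2l ?mulr_ge0 ?sqr_ge0//.
  rewrite -(subrKA (rhs P)) /ax (distrC (opA P q u)).
  exact: ler_normD.
set y := `|_ + _ - _| in hx *.
have x0 : 0 <= x by exact: normr_ge0.
have a0 : 0 <= a by exact: normr_ge0.
have y0 : 0 <= y by exact: normr_ge0.
have hx2 : x ^+ 2 <= 2 * y ^+ 2 + 4 * ctc ^+ 2 * (a ^+ 2 + x ^+ 2).
  have e : ctc * (a + x) = ctc * a + ctc * x by ring.
  have h1 := sqr_leD2 x0 hx.
  have h2 : (ctc * (a + x)) ^+ 2 <= 2 * (ctc ^+ 2 * a ^+ 2 + ctc ^+ 2 * x ^+ 2).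
    by rewrite -!exprMn e mulrDr sqr_leD2 ?mulr_ge0// ?addr_ge0// ?mulr_ge0.
  by lra.
have := ler_wpM2l vrho_ge0 hax.
by lra.
Qed.

End gauss_newton_step.

(** * Scalar inequalities *)

(** Once [s] is below [(1 - c) * (e / 2)], the shifted values [a k - e / 2] contract by the factor
    [c], so they cannot all stay above [e / 2]. *)
Lemma contraction_not_bounded_below (R : realType) (a s : nat -> R) (c e : R)
    (K : nat) : 0 <= c < 1 -> 0 < e -> s @ \oo --> 0 ->
  (forall k, (K <= k)%N -> a k.+1 <= c * a k + s k) ->
  (forall k, e <= a k) -> False.
Proof.
move=> /andP[c0 c1] e0 s0 rec ea.
have d0 : 0 < (1 - c) * (e / 2) by rewrite mulr_gt0 ?divr_gt0 ?subr_gt0.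
have /cvgrPdist_lt/(_ _ d0)[N _ sN] := s0.
pose M := maxn K N.
have bound n : a (M + n)%N - e / 2 <= c ^+ n * (a M - e / 2).
  elim: n => [|n IH]; first by rewrite addn0 expr0 mul1r.
  have Mn : (M <= M + n)%N by exact: leq_addr.
  have := rec (M + n)%N (leq_trans (leq_maxl _ _) Mn).
  have := sN (M + n)%N (leq_trans (leq_maxr _ _) Mn).
  rewrite /= sub0r normrN addnS exprS -mulrA => /(le_lt_trans (ler_norm _)).
  by have := ler_wpM2l c0 IH; lra.
have h : c ^+ n * (a M - e / 2) @[n --> \oo] --> 0 * (a M - e / 2).
  by apply: cvgM; [apply: cvg_expr; rewrite ger0_norm|exact: cvg_cst].
have : e / 2 <= 0 * (a M - e / 2).
  apply: (cvgr_to_ge h); apply: nearW => n.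
  by have := bound n; have := ea (M + n)%N; lra.
by rewrite mul0r; lra.
Qed.

(** The sharp constant is the square root of 2; the value 2 avoids the root. *)
Lemma addr_le_double_of_sqr (R : realFieldType) (a b x y : R) :
  0 <= a -> 0 <= b -> 0 <= x -> 0 <= y ->
  a ^+ 2 + b ^+ 2 <= x ^+ 2 + y ^+ 2 -> a + b <= 2 * (x + y).
Proof.
move=> a0 b0 x0 y0 h.
rewrite -(@ler_pXn2r _ 2)// ?nnegrE ?mulr_ge0// ?addr_ge0//.
have := sqr_ge0 (a - b); have := mulr_ge0 x0 y0; nra.
Qed.

(* The slack of the accuracy condition: replacing ctc by 2 ctc in
   (1 + ctc)^2 / tau^2 gains a term linear in ctc, which for small ctc absorbs
   the quadratic terms. *)
Lemma accuracy_slack (R : realFieldType)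
    (ctc tau tlo c1 delta a2 w I3h eta1 eta3 : R) :
  0 < ctc -> 0 < c1 -> 0 < tau -> ctc * (1 + c1) * tau ^+ 2 <= 1 ->
  0 <= a2 -> 0 <= w -> `|I3h - (a2 + w)| <= eta3 -> eta3 <= c1 * I3h ->
  eta1 + 4 * ctc ^+ 2 * eta3 <=
    (tlo - 2 * (2 * ctc ^+ 2 + (1 + 2 * ctc) ^+ 2 / tau ^+ 2)) * I3h ->
  tau ^+ 2 * delta ^+ 2 < I3h ->
  2 * ctc ^+ 2 * a2 + 2 * (1 + ctc) ^+ 2 * delta ^+ 2 + 8 * ctc ^+ 2 * w +
    eta1 + 6 * ctc ^+ 2 * delta ^+ 2 <= tlo * I3h.
Proof.
move=> k0 c10 t0 small a20 w0 e3 e3c e1 disc.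
have t2 : 0 < tau ^+ 2 by rewrite exprn_gt0.
set s := I3h / tau ^+ 2.
have sE : I3h = tau ^+ 2 * s by rewrite /s mulrCA divff ?mulr1// gt_eqF.
have ds : delta ^+ 2 <= s by rewrite /s ler_pdivlMr// mulrC ltW.
have s0 : 0 <= s by apply: le_trans ds; exact: sqr_ge0.
have {}e1 : eta1 + 4 * ctc ^+ 2 * eta3 <=
    tlo * I3h - 4 * ctc ^+ 2 * I3h - 2 * (1 + 2 * ctc) ^+ 2 * s.
  by apply: le_trans e1 _; rewrite le_eqVlt; apply/orP; left; apply/eqP;
    rewrite /s; field; rewrite gt_eqF.
(* The [w] term carries the factor 8, while [e1] provides only [4 * ctc ^+ 2 * (I3h + eta3)]; this
   bound covers the other half. *)
have small' : 4 * ctc ^+ 2 * (1 + c1) * I3h <= 4 * ctc * s.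
  rewrite sE.
  have -> : 4 * ctc ^+ 2 * (1 + c1) * (tau ^+ 2 * s) =
    (ctc * (1 + c1) * tau ^+ 2) * (4 * ctc * s) by ring.
  by rewrite ler_piMl// mulr_ge0// mulr_ge0// ltW.
have k2 : 0 < ctc ^+ 2 by rewrite exprn_gt0.
have a2w : a2 + w <= I3h + eta3 by move: e3; rewrite ler_norml; lra.
have h1 := ler_wpM2l (ltW k2) a2w.
have h2 := ler_wpM2l (ltW k2) e3c.
have h3 := mulr_ge0 (ltW k2) a20.
have h4 : (2 * (1 + ctc) ^+ 2 + 6 * ctc ^+ 2) * delta ^+ 2 <=
    (2 * (1 + ctc) ^+ 2 + 6 * ctc ^+ 2) * s.
  by rewrite ler_wpM2l// addr_ge0// mulr_ge0// ?sqr_ge0.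
(* The gain: [4 * ctc * s] pays for [small'], and [6 * ctc ^+ 2 * s] leaves the margin
   [6 * ctc ^+ 2 * delta ^+ 2] of the conclusion. *)
have E2 : 2 * (1 + 2 * ctc) ^+ 2 * s = (2 * (1 + ctc) ^+ 2 + 6 * ctc ^+ 2) * s
  + 4 * ctc * s by ring.
by lra.
Qed.

(** The estimate [h] for the continuous quantities is carried over to the discrete ones, where the
    upper window bound applies. Besides [c2 * I3h] only discretization errors remain. *)
Lemma residual_contraction (R : realFieldType) (ctc thi c2 c3 : R)
    (I2h I2c I3h I3c I4h I4c I3n eta2 eta3 eta4 r : R) :
  4 * ctc ^+ 2 < 1 -> 0 < c3 -> 0 <= I3h ->
  (1 - 4 * ctc ^+ 2) * I4c <= 2 * I2c + 4 * ctc ^+ 2 * I3c ->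
  `|I2h - I2c| <= eta2 -> `|I3h - I3c| <= eta3 -> `|I4h - I4c| <= eta4 ->
  I3n <= (1 + c3) * I4h + r ->
  (1 + c3) * ((2 * thi + 4 * ctc ^+ 2) / (1 - 4 * ctc ^+ 2)) <= c2 ->
  I2h <= thi * I3h ->
  I3n <= c2 * I3h +
    ((1 + c3) * ((2 * eta2 + 4 * ctc ^+ 2 * eta3) / (1 - 4 * ctc ^+ 2) + eta4)
     + r).
Proof.
move=> ctc_lt c3_gt0 I0 h h2 h3 h4 h5 hc w2.
have d0 : 0 < 1 - 4 * ctc ^+ 2 by rewrite subr_gt0.
have k2 : 0 <= ctc ^+ 2 by exact: sqr_ge0.
have {}h : I4c <= (2 * thi + 4 * ctc ^+ 2) / (1 - 4 * ctc ^+ 2) * I3h +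
    (2 * eta2 + 4 * ctc ^+ 2 * eta3) / (1 - 4 * ctc ^+ 2).
  rewrite mulrAC -mulrDl ler_pdivlMr// mulrC; apply: le_trans h _.
  have h3' : I3c <= I3h + eta3 by move: h3; rewrite ler_norml; lra.
  by move: h2 (ler_wpM2l k2 h3'); rewrite ler_norml; lra.
have c30 : 0 <= 1 + c3 by rewrite addr_ge0// ltW.
have h6 : I4h <= I4c + eta4 by move: h4; rewrite ler_norml; lra.
have := ler_wpM2l c30 (le_trans h6 (lerD h (lexx _))).
by move: (ler_wpM2r I0 hc) h5; lra.
Qed.

(** * One run: bounded iterates, termination, and residuals at stopping *)

Section one_run.
Context {R : realType} {Q V G W : hilbertType R}.
Variables (P : problem Q V G W) (X : run Q V G W) (qd : Q) (ud : V).
Variables (tau tlo thi c1 c2 c3 ctc cadj vrho delta : R).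
Hypotheses (tau_gt0 : 0 < tau) (c1_gt0 : 0 < c1) (c2_gt0 : 0 < c2)
  (c3_gt0 : 0 < c3).
Hypotheses (ctc_gt0 : 0 < ctc) (ctc_lt : 4 * ctc ^+ 2 < 1)
  (ctc_small : ctc * (1 + c1) * tau ^+ 2 <= 1).
Hypotheses (solP : exact_solution P qd ud) (cone : tangential_cone P ctc).
Hypotheses (vrho_gt0 : 0 < vrho)
  (vrhoP : cadj * (`|qd - initq P| + `|ud - initu P| + 1) <= vrho).
Hypotheses (delta_gt0 : 0 < delta) (iter : iteration P X delta)
  (adj : adjoint_bound P X cadj)
  (acc : discretization_accuracy P vrho X ctc tau tlo thi c1 c2 c3)
  (window : forall k, (0 < k)%N ->
    tlo * I3h P vrho X k <= I2h P X k <= thi * I3h P vrho X k).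

Let inball_d : inball P (qd, ud). Proof. by case: solP. Qed.
Let solution_d : solution P qd ud. Proof. by case: solP. Qed.

Lemma inball_dist0 q u : dist0 P q u <= dist0 P qd ud -> inball P (q, u).
Proof. by move=> /le_lt_trans; apply; exact: inball_d. Qed.

(** The multiplier bound involves a sum of norms, whereas only the sum of squares of the old iterate
    is controlled; passing from one to the other costs the factor 2. *)
Lemma adjoint_le k z : (0 < k)%N ->
  dist0 P (qold X k) (uold X k) <= dist0 P qd ud ->
  stationary P full_level (gdelta X) (beta X k) (qold X k) (uold X k)
    (qc X k) (uc X k) z -> `|z| <= 2 * vrho.
Proof.
move=> k0 old st.
have h := adj k0 (or_introl erefl) (inball_dist0 old) st.
have hs : `|qold X k - initq P| + `|uold X k - initu P| <=
    2 * (`|qd - initq P| + `|ud - initu P|).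
  by apply: addr_le_double_of_sqr => //; exact: normr_ge0.
move: vrhoP hs h; set y := `|qd - _| + _.
set x := `|qold X k - _| + _ => hv hs h.
have x1 : 0 < x + 1 by rewrite ltr_wpDl// addr_ge0.
(* The sign of [cadj] comes from [h], whose left-hand side is a norm. *)
have cadj0 : 0 <= cadj by rewrite -(pmulr_lge0 _ x1) (le_trans _ h).
by have := ler_wpM2l cadj0 hs; move: h hv; rewrite !mulrDr; lra.
Qed.

(** Common source of the bounds on discrete and continuous iterates. The margin
    [6 * ctc ^+ 2 * delta ^+ 2] is kept to absorb [eta2] in the continuous case. *)
Lemma step_estimate k qs us : (0 < k)%N ->
  dist0 P (qold X k) (uold X k) <= dist0 P qd ud ->
  tau ^+ 2 * delta ^+ 2 < I3h P vrho X k ->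
  inball P (qs, us) -> solution P qs us ->
  I1c P X k + eta1 X k + 6 * ctc ^+ 2 * delta ^+ 2 <=
    (beta X k)^-1 * dist0 P qs us + tlo * I3h P vrho X k.
Proof.
move=> k0 old disc bs ss.
have [dg _ _ /(_ k k0)[b0 _ _ [z st]]] := iter.
have zr := adjoint_le k0 old st.
have := I1_stationary_le (ltW ctc_gt0) cone b0 st (inball_dist0 old) bs ss dg
  zr.
have [/(_ k k0)[_ _ h3 _] /(_ k k0)[h1 h3c] _ _ _] := acc.
have a20 : 0 <= `|opC P (uold X k) - gdelta X| ^+ 2 by exact: sqr_ge0.
have w0 : 0 <= vrho * `|opA P (qold X k) (uold X k) - rhs P|.
  by rewrite mulr_ge0// ltW.
have := accuracy_slack ctc_gt0 c1_gt0 tau_gt0 ctc_small a20 w0 h3 h3c h1 disc.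
by rewrite /I1c; lra.
Qed.

(** Passing from [I1c] to [I1h] costs [eta1], and [tlo * I3h] is at most the [I2h] contained in
    [I1h]; cancelling it leaves the penalty terms. *)
Lemma discrete_step_le k qs us : (0 < k)%N ->
  dist0 P (qold X k) (uold X k) <= dist0 P qd ud ->
  tau ^+ 2 * delta ^+ 2 < I3h P vrho X k ->
  inball P (qs, us) -> solution P qs us ->
  dist0 P (qh X k) (uh X k) <= dist0 P qs us.
Proof.
move=> k0 old disc bs ss; have := step_estimate k0 old disc bs ss.
have [_ _ _ /(_ k k0)[b0 [_ _ _ [_ _ nV]] _ _]] := iter.
have [/(_ k k0)[h1 _ _ _] _ _ _ _] := acc.
have /andP[w1 _] := window k0.
have e0 : 0 <= 6 * ctc ^+ 2 * delta ^+ 2.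
  by rewrite mulr_ge0 ?sqr_ge0// mulr_ge0 ?sqr_ge0.
move=> h; have : I1h P X k <= (beta X k)^-1 * dist0 P qs us + I2h P X k.
  by move: h1; rewrite ler_norml; lra.
rewrite /I1h /I1 -/(I2h P X k) [leLHS]addrC lerD2r ler_pM2l ?invr_gt0//.
(* So far the state is controlled in the norm [normV], which dominates that of [V]. *)
move=> hd; apply: le_trans hd; rewrite lerD2l ler_pXn2r// nnegrE.
  exact: normr_ge0.
by apply: le_trans (nV _); exact: normr_ge0.
Qed.

(** The window concerns [I2h], so cancelling [I2c] costs [eta2], which the margin of [step_estimate]
    covers. *)
Lemma continuous_step_le k : (0 < k)%N ->
  dist0 P (qold X k) (uold X k) <= dist0 P qd ud ->
  tau ^+ 2 * delta ^+ 2 < I3h P vrho X k ->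
  eta2 X k <= 6 * ctc ^+ 2 * delta ^+ 2 ->
  dist0 P (qc X k) (uc X k) <= dist0 P qd ud.
Proof.
move=> k0 old disc e2; have := step_estimate k0 old disc inball_d solution_d.
have [_ _ _ /(_ k k0)[b0 _ _ _]] := iter.
have [/(_ k k0)[h1 h2 _ _] _ _ _ _] := acc.
have /andP[w1 _] := window k0.
have e1 : 0 <= eta1 X k by apply: le_trans h1.
move=> h; have : I1c P X k <= (beta X k)^-1 * dist0 P qd ud + I2c P X k.
  by move: h2; rewrite ler_norml; lra.
by rewrite /I1c /I1 -/(I2c P X k) [leLHS]addrC lerD2r ler_pM2l ?invr_gt0.
Qed.

Lemma iterates_bounded k qs us :
  (forall j, (j < k)%N -> ~ discrepancy P vrho X tau delta j) ->
  inball P (qs, us) -> solution P qs us ->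
  dist0 P (qh X k) (uh X k) <= dist0 P qs us.
Proof.
(* The comparison solution varies in the induction: the next step needs the old iterate compared
   with [(qd, ud)], whatever [(qs, us)] is. *)
elim: k qs us => [|k IH] qs us nd bs ss.
  have [_ -> -> _] := iter.
  by rewrite /dist0 !subrr !normr0 expr0n addr0 addr_ge0// sqr_ge0.
apply: discrete_step_le => //; last by rewrite ltNge; apply/negP; exact: nd.
by apply: IH => // j jk; apply: nd; rewrite ltnS ltnW.
Qed.

Lemma residual_step k : (0 < k)%N ->
  dist0 P (qold X k) (uold X k) <= dist0 P qd ud ->
  dist0 P (qc X k) (uc X k) <= dist0 P qd ud ->
  0 <= I3h P vrho X k ->
  I3h P vrho X k.+1 <= c2 * I3h P vrho X k +
    ((1 + c3) * ((2 * eta2 X k + 4 * ctc ^+ 2 * eta3 X k) / (1 - 4 * ctc ^+ 2)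
      + eta4 X k) + rterm X k.+1).
Proof.
move=> k0 old cur I0.
have [_ _ _ /(_ k k0)[_ _ _ [z st]]] := iter.
have h := I34_stationary_le (ltW ctc_gt0) cone (ltW vrho_gt0) ctc_lt st
  (inball_dist0 old) (inball_dist0 cur).
have [/(_ k k0)[_ h2 h3 h4] _ _ [/(_ k.+1 k0) h5 _] /andP[hc _]] := acc.
have /andP[_ w2] := window k0.
exact: residual_contraction h h2 h3 h4 h5 hc w2.
Qed.

Lemma stopping_index_exists : exists k, stopping_index P vrho X tau delta k.
Proof.
have [[k kP]|none] := pselect (exists k, discrepancy P vrho X tau delta k).
  have kb : exists k, `[< discrepancy P vrho X tau delta k >].
    by exists k; apply/asboolP.
  case: (ex_minnP kb) => m /asboolP mP mmin; exists m; split=> // j jm jP.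
  by move: jm; rewrite ltnNge mmin//; apply/asboolP.
exfalso.
have nd k : tau ^+ 2 * delta ^+ 2 < I3h P vrho X k.+1.
  by rewrite ltNge; apply/negP => h; apply: none; exists k.
have old k : (0 < k)%N -> dist0 P (qold X k) (uold X k) <= dist0 P qd ud.
  by move=> _; apply: iterates_bounded => // j _ jd; apply: none; exists j.
have [_ _ [e2 e3 e4] [_ r0] /andP[hc c2lt]] := acc.
(* Here [delta] is fixed and positive, so [eta2] eventually fits into the margin and the continuous
   iterates lie in the ball. *)
have [K _ KP] : \forall k \near \oo, eta2 X k <= 6 * ctc ^+ 2 * delta ^+ 2.
  apply: (cvgr_le _ e2).
  by rewrite mulr_gt0 ?exprn_gt0// mulr_gt0 ?exprn_gt0.
have td : 0 < tau ^+ 2 * delta ^+ 2 by rewrite mulr_gt0// exprn_gt0.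
(* Indices are shifted by one because steps start at 1; the recursion runs on [I3h] at [k.+1]. *)
pose s k := (1 + c3) * ((2 * eta2 X k.+1 + 4 * ctc ^+ 2 * eta3 X k.+1) /
  (1 - 4 * ctc ^+ 2) + eta4 X k.+1) + rterm X k.+2.
apply: (@contraction_not_bounded_below R (fun k => I3h P vrho X k.+1) s
  c2 _ K _ td) => [| |k Kk|k]; last exact: ltW.
- by rewrite (ltW c2_gt0).
- have h2 : eta2 X k.+1 @[k --> \oo] --> 0 by rewrite cvg_shiftS.
  have h3 : eta3 X k.+1 @[k --> \oo] --> 0 by rewrite cvg_shiftS.
  have h4 : eta4 X k.+1 @[k --> \oo] --> 0 by rewrite cvg_shiftS.
  have hr : rterm X k.+2 @[k --> \oo] --> 0.
    by rewrite (cvg_shiftS (fun k => rterm X k.+1)) cvg_shiftS.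
  have -> : 0 = (1 + c3) * ((2 * 0 + 4 * ctc ^+ 2 * 0) / (1 - 4 * ctc ^+ 2) + 0)
    + 0 :> R by ring.
  apply: cvgD hr; apply: cvgM; first exact: cvg_cst.
  apply: cvgD h4; apply: cvgM; last exact: cvg_cst.
  by apply: cvgD; apply: cvgM => //; exact: cvg_cst.
- apply: residual_step => //; first exact: old.
    apply: continuous_step_le => //; first exact: old.
    by apply: KP; rewrite /= (leq_trans Kk).
  by rewrite ltW// (lt_trans td).
Qed.

(** [I3h] sees only the dual norm over the discrete space; [eta3 <= c1 * I3h] carries the
    discrepancy bound over to [I3c], whose two summands are then bounded separately, with constants
    independent of [delta]. *)
Lemma stopping_residual k : discrepancy P vrho X tau delta k ->
  `|opC P (uh X k) - obs P| <= ((1 + c1) * tau + 1) * delta /\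
  `|opA P (qh X k) (uh X k) - rhs P| <= (1 + c1) * tau ^+ 2 / vrho * delta ^+ 2.
Proof.
rewrite /discrepancy => hk.
have [dg _ _ _] := iter.
have [/(_ k.+1 isT)[_ _ h3 _] /(_ k.+1 isT)[_ h3c] _ _ _] := acc.
have : I3c P vrho X k.+1 <= (1 + c1) * (tau ^+ 2 * delta ^+ 2).
  have c10 : 0 <= 1 + c1 by rewrite addr_ge0// ltW.
  by move: h3 (ler_wpM2l c10 hk); rewrite ler_norml; lra.
rewrite /I3c /I34 /qold /uold /= dual_normE => h; split.
  have -> : opC P (uh X k) - obs P =
      opC P (uh X k) - gdelta X - (obs P - gdelta X).
    by rewrite opprB addrA subrK.
  apply: le_trans (ler_normB _ _) _; rewrite mulrDl mul1r lerD//.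
  rewrite -(@ler_pXn2r _ 2)// ?nnegrE//; last first.
    by rewrite mulr_ge0 ?mulr_ge0 ?addr_ge0 ?(ltW c1_gt0) ?(ltW tau_gt0) ?ltW.
  have w0 : 0 <= vrho * `|opA P (qh X k) (uh X k) - rhs P|.
    by rewrite mulr_ge0// ltW.
  have td : 0 <= tau ^+ 2 * delta ^+ 2 by rewrite mulr_ge0// sqr_ge0.
  (* Replacing [1 + c1] by its square avoids a root in the constant. *)
  have cc : 1 + c1 <= (1 + c1) ^+ 2.
    by rewrite expr2 ler_peMr// ?lerDl ltW// ltr_wpDl.
  by have := ler_wpM2r td cc; lra.
rewrite mulrAC ler_pdivlMr// mulrC.
by have := sqr_ge0 `|opC P (uh X k) - gdelta X|; lra.
Qed.

End one_run.

(** * Subsequences and convergence criteria *)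

Lemma leq_homo_ltn (phi : nat -> nat) n :
  {homo phi : m n / (m < n)%N} -> (n <= phi n)%N.
Proof. by move=> h; elim: n => // n /leq_ltn_trans; apply; exact: h. Qed.

Lemma cvg_subseq (T : topologicalType) (u : nat -> T) (l : T)
    (phi : nat -> nat) : {homo phi : m n / (m < n)%N} ->
  u @ \oo --> l -> u (phi n) @[n --> \oo] --> l.
Proof.
move=> hphi; apply: cvg_comp => A [N _ NA]; exists N => // n /= Nn.
by apply: NA; rewrite /= (leq_trans Nn)// leq_homo_ltn.
Qed.

Lemma cvg_of_norm_dist (R : realType) (X : normedModType R) (u : nat -> X) l
    (e : nat -> R) : e @ \oo --> 0 -> (forall n, `|u n - l| <= e n) ->
  u @ \oo --> l.
Proof.
move=> e0 ue; apply/cvgrPdist_lt => d d0; near=> n; rewrite distrC.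
by apply: le_lt_trans (ue n) _; near: n; exact: (cvgr_lt _ e0).
Unshelve. all: by end_near. Qed.

Lemma cvg_of_sqr_dist (R : realType) (X : normedModType R) (u : nat -> X) l
    (e : nat -> R) : e @ \oo --> 0 -> (forall n, `|u n - l| ^+ 2 <= e n) ->
  u @ \oo --> l.
Proof.
move=> e0 ue; apply/cvgrPdist_lt => d d0.
have d2 : 0 < d ^+ 2 by rewrite exprn_gt0.
near=> n; rewrite -(@ltr_pXn2r _ 2)// ?nnegrE ?(ltW d0)// distrC.
apply: le_lt_trans (ue n) _; near: n.
exact: (cvgr_lt _ e0).
Unshelve. all: by end_near. Qed.

(** Subsequence principle: if convergence fails, some null sequence keeps [f] at distance at least
    [e] from [l] at every index, so a single index contradicts convergence after reindexing. *)
Lemma cvg_at_right0_subseq (R : realType) (X : normedModType R) (f : R -> X)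
    (l : X) :
  (forall d_ : nat -> R, (forall n, 0 < d_ n) -> d_ n @[n --> \oo] --> 0 ->
    exists phi : nat -> nat, f (d_ (phi n)) @[n --> \oo] --> l) ->
  f d @[d --> 0^'+] --> l.
Proof.
move=> h; apply/cvgrPdist_lt => e e0; apply: contrapT => nf.
have /choice[d_ dP] : forall n, exists d : R,
    [/\ 0 < d, d < n.+1%:R^-1 & e <= `|l - f d|].
  move=> n; apply: contrapT => nd; apply: nf.
  near=> d; have d0 : 0 < d by near: d; exact: nbhs_right_gt.
  have dn : d < n.+1%:R^-1.
    by near: d; apply: nbhs_right_lt; rewrite invr_gt0.
  by rewrite ltNge; apply/negP => ed; apply: nd; exists d.
have [||phi /cvgrPdist_lt/(_ _ e0)[N _ /(_ N (leqnn N))]] := h d_.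
- by move=> n; have [] := dP n.
- apply/cvgrPdist_lt => x x0; near=> n; have [d0 dn _] := dP n.
  rewrite sub0r normrN gtr0_norm//; apply: lt_trans dn _; near: n.
  exact: (near_infty_natSinv_lt (PosNum x0)).
- by have [_ _ /le_lt_trans h' /h'] := dP (phi N); rewrite ltxx.
Unshelve. all: by end_near. Qed.

(** * Weak limits of iterates are strong limits and solutions *)

Section weak_limits.
Context {R : realType} {Q V G W : hilbertType R}.
Variables (P : problem Q V G W) (qd : Q) (ud : V).
Hypotheses (solP : exact_solution P qd ud)
  (closedP : continuous_weakly_closed P).

(* Every solution in the ball, not just the given one, bounds the distance of
   the sequence to the initial guess. Applied to the weak limit itself, this
   turns weak into strong convergence. *)
Lemma weak_limit_strong (q_ : nat -> Q) (u_ : nat -> V) q u :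
  (forall n qs us, inball P (qs, us) -> solution P qs us ->
    dist0 P (q_ n) (u_ n) <= dist0 P qs us) ->
  opC P (u_ n) @[n --> \oo] --> obs P ->
  opA P (q_ n) (u_ n) @[n --> \oo] --> rhs P ->
  weak_cvg q_ q -> weak_cvg u_ u ->
  [/\ q_ @ \oo --> q, u_ @ \oo --> u & solution P q u].
Proof.
move=> near0 cC cA wq wu; have [bd sd dom] := solP.
have bn n : inball P (q_ n, u_ n).
  exact: le_lt_trans (near0 n _ _ bd sd) bd.
have sol : solution P q u.
  have [_ /(_ q_ u_ q u (obs P) (rhs P))[]] := closedP => //.
  by move=> n; exact: dom (bn n).
have iq := inner_weak_lim (x0 := initq P) wq.
have iu := inner_weak_lim (x0 := initu P) wu.
have b : inball P (q, u).
  apply: le_lt_trans (bd).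
  (* Weak lower semicontinuity: twice the inner product of two vectors is at most the sum of their
     squared norms, and the inner products tend to [dist0 P q u]. *)
  have : dist0 P q u <= 2^-1 * (dist0 P qd ud + dist0 P q u).
    apply: (cvgr_to_le (cvgD iq iu)); apply: nearW => n; rewrite fctE.
    have := near0 n _ _ bd sd; rewrite /dist0.
    have := sqr_ge0 `|q_ n - initq P - (q - initq P)|.
    have := sqr_ge0 `|u_ n - initu P - (u - initu P)|.
    by rewrite !normB_sqr; lra.
  by rewrite /= -/(dist0 P q u) -/(dist0 P qd ud); lra.
(* The expanded squared distance to the limit, with the norm of the iterate replaced by its bound
   [dist0 P q u]. *)
pose e n := 2 * (dist0 P q u - (inner (q_ n - initq P) (q - initq P) +
  inner (u_ n - initu P) (u - initu P))).
have e0 : e @ \oo --> 0.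
  rewrite -[0](mulr0 2) -[X in 2 * X](subrr (dist0 P q u)).
  apply: cvgM; first exact: cvg_cst.
  by apply: cvgB; [exact: cvg_cst|exact: cvgD].
have d2 n : `|q_ n - q| ^+ 2 + `|u_ n - u| ^+ 2 <= e n.
  have := near0 n _ _ b sol; rewrite /e /dist0.
  have -> : q_ n - q = q_ n - initq P - (q - initq P).
    by rewrite opprB addrA subrK.
  have -> : u_ n - u = u_ n - initu P - (u - initu P).
    by rewrite opprB addrA subrK.
  by rewrite !normB_sqr; lra.
split=> //; apply: cvg_of_sqr_dist e0 _ => n; apply: le_trans (d2 n).
  by rewrite lerDl sqr_ge0.
by rewrite lerDr sqr_ge0.
Qed.

(** A second extraction, for the states, is made along the first one; the weak limit of the
    parameters persists. *)
Lemma weak_subseq_pair (q_ : nat -> Q) (u_ : nat -> V) (M : R) :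
  (forall n, dist0 P (q_ n) (u_ n) <= M) ->
  exists phi : nat -> nat, {homo phi : m n / (m < n)%N} /\
    exists q u, weak_cvg (q_ \o phi) q /\ weak_cvg (u_ \o phi) u.
Proof.
move=> hM.
(* [M + 1] serves as a root-free bound for the square root of [M]. *)
have sq (x y : R) : 0 <= x -> x ^+ 2 + y ^+ 2 <= M -> x <= M + 1.
  by move=> x0; have := sqr_ge0 y; have := sqr_ge0 (x - 1); nra.
have qM n : `|q_ n| <= M + 1 + `|initq P|.
  rewrite -(subrK (initq P) (q_ n)) (le_trans (ler_normD _ _))// lerD2r.
  exact: sq (hM n).
have uM n : `|u_ n| <= M + 1 + `|initu P|.
  rewrite -(subrK (initu P) (u_ n)) (le_trans (ler_normD _ _))// lerD2r.
  have := hM n; rewrite /dist0 addrC; exact: sq.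
have [phi [hphi [q wq]]] := bounded_weak_subseq qM.
have [psi [hpsi [u wu]]] := bounded_weak_subseq (fun n => uM (phi n)).
exists (phi \o psi); split; first by move=> m n /hpsi/hphi.
exists q, u; split => // f.
exact: (cvg_subseq (u := fun n => f (q_ (phi n))) hpsi (wq f)).
Qed.

End weak_limits.

(** * Choice of the smallness threshold and passage to vanishing noise *)

Theorem theorem3 (R : realType) (tau tlo thi c1 c2 c3 : R)
    (tau_gt0 : 0 < tau) (c1_gt0 : 0 < c1) (c2_gt0 : 0 < c2) (c3_gt0 : 0 < c3) :
  exists2 cbar : R, 0 < cbar &
  forall (Q V G W : hilbertType R) (P : problem Q V G W) (qd : Q) (ud : V)
    (ctc cadj vrho : R) (X : R -> run Q V G W),
  0 < rho P ->
  0 < ctc < 1 ->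
  ctc < cbar ->
  has_derivatives P ->
  exact_solution P qd ud ->
  well_posed P ->
  continuous_weakly_closed P ->
  tangential_cone P ctc ->
  parameter_bounds ctc tau tlo thi ->
  uniform_bounds P ->
  0 < vrho ->
  cadj * (`|qd - initq P| + `|ud - initu P| + 1) <= vrho ->
  (forall delta, 0 < delta ->
    [/\ iteration P (X delta) delta,
        adjoint_bound P (X delta) cadj,
        discretization_accuracy P vrho (X delta) ctc tau tlo thi c1 c2 c3 &
        forall k, (0 < k)%N ->
          tlo * I3h P vrho (X delta) k <= I2h P (X delta) k
            <= thi * I3h P vrho (X delta) k]) ->
  exists kstar : R -> nat,
  [/\ (forall delta, 0 < delta ->
        stopping_index P vrho (X delta) tau delta (kstar delta)),
      (forall delta k, 0 < delta -> (k <= kstar delta)%N ->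
        `|qh (X delta) k - initq P| ^+ 2 + `|uh (X delta) k - initu P| ^+ 2
          <= `|qd - initq P| ^+ 2 + `|ud - initu P| ^+ 2) &
      let qs delta := qh (X delta) (kstar delta) in
      let us delta := uh (X delta) (kstar delta) in
      (forall d_ : nat -> R, (forall n, 0 < d_ n) -> d_ n @[n --> \oo] --> 0 ->
        (exists phi : nat -> nat, {homo phi : m n / (m < n)%N} /\
          exists q u, weak_cvg (fun n => qs (d_ (phi n))) q /\
                      weak_cvg (fun n => us (d_ (phi n))) u) /\
        (forall (phi : nat -> nat) q u, {homo phi : m n / (m < n)%N} ->
          weak_cvg (fun n => qs (d_ (phi n))) q ->
          weak_cvg (fun n => us (d_ (phi n))) u ->
          [/\ qs (d_ (phi n)) @[n --> \oo] --> q,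
              us (d_ (phi n)) @[n --> \oo] --> u & solution P q u])) /\
      ((forall q u, solution P q u -> q = qd /\ u = ud) ->
        qs delta @[delta --> 0^'+] --> qd /\
        us delta @[delta --> 0^'+] --> ud)].
Proof.
(* The first entry gives [4 * ctc ^+ 2 < 1], the second the smallness relative to [tau] and [c1]
   that [accuracy_slack] asks for. The threshold depends on [tau] and [c1] alone, hence neither on
   the problem nor on [delta]. *)
pose cbar := Num.min 2^-1 (((1 + c1) * tau ^+ 2)^-1).
have D0 : 0 < (1 + c1) * tau ^+ 2 by rewrite mulr_gt0 ?exprn_gt0// addr_gt0.
exists cbar; first by rewrite lt_min !invr_gt0 ltr0n.
move=> Q V G W P qd ud ctc cadj vrho X _ /andP[ctc0 _].
rewrite lt_min => /andP[ctc2 ctcD] _ solP _ closedP cone _ _ vrho0 vrhoP runs.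
have ctc_lt : 4 * ctc ^+ 2 < 1 by nra.
have ctc_small : ctc * (1 + c1) * tau ^+ 2 <= 1.
  by rewrite -mulrA -ler_pdivlMr// div1r ltW.
(* [kstar] is total on the reals; the index 0 is a default for [delta <= 0]. *)
have /choice[kstar kP] : forall delta, exists k, 0 < delta ->
    stopping_index P vrho (X delta) tau delta k.
  move=> delta; have [d0|] := pselect (0 < delta); last by exists 0%N.
  have [it adj acc win] := runs _ d0.
  have [k kP] := stopping_index_exists tau_gt0 c1_gt0 c2_gt0 c3_gt0 ctc0 ctc_lt
    ctc_small solP cone vrho0 vrhoP d0 it adj acc win.
  by exists k.
have bound delta k qs us : 0 < delta -> (k <= kstar delta)%N ->
    inball P (qs, us) -> solution P qs us ->
    dist0 P (qh (X delta) k) (uh (X delta) k) <= dist0 P qs us.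
  move=> d0 kk; have [it adj acc win] := runs _ d0.
  apply: (iterates_bounded tau_gt0 c1_gt0 ctc0 ctc_small solP cone vrho0 vrhoP
    it adj acc win) => j jk.
  by have [_ h] := kP _ d0; apply: h; exact: leq_trans kk.
have [bd sd _] := solP.
exists kstar; split=> //.
  by move=> delta k d0 kk; exact: bound d0 kk bd sd.
move=> qs us.
have main (d_ : nat -> R) : (forall n, 0 < d_ n) -> d_ n @[n --> \oo] --> 0 ->
    (exists phi : nat -> nat, {homo phi : m n / (m < n)%N} /\
      exists q u, weak_cvg (fun n => qs (d_ (phi n))) q /\
                  weak_cvg (fun n => us (d_ (phi n))) u) /\
    (forall (phi : nat -> nat) q u, {homo phi : m n / (m < n)%N} ->
      weak_cvg (fun n => qs (d_ (phi n))) q ->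
      weak_cvg (fun n => us (d_ (phi n))) u ->
      [/\ qs (d_ (phi n)) @[n --> \oo] --> q,
          us (d_ (phi n)) @[n --> \oo] --> u & solution P q u]).
  move=> d_gt0 d_0; split.
    apply: (weak_subseq_pair (P := P) (M := dist0 P qd ud)
      (q_ := fun n => qs (d_ n)) (u_ := fun n => us (d_ n))) => n.
    exact: bound (d_gt0 n) (leqnn _) bd sd.
  move=> phi q u hphi wq wu.
  pose d n := d_ (phi n).
  have d0 n : 0 < d n by exact: d_gt0.
  have dc : d @ \oo --> 0 by exact: cvg_subseq d_0.
  have res n : `|opC P (us (d n)) - obs P| <= ((1 + c1) * tau + 1) * d n /\
      `|opA P (qs (d n)) (us (d n)) - rhs P| <=
        (1 + c1) * tau ^+ 2 / vrho * d n ^+ 2.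
    have [it _ acc _] := runs _ (d0 n); have [disc _] := kP _ (d0 n).
    exact: (stopping_residual tau_gt0 c1_gt0 vrho0 (d0 n) it acc disc).
  have near0 n qs' us' : inball P (qs', us') -> solution P qs' us' ->
      dist0 P (qs (d n)) (us (d n)) <= dist0 P qs' us'.
    by move=> *; exact: bound.
  apply: (weak_limit_strong solP closedP near0 _ _ wq wu).
    apply: (cvg_of_norm_dist _ (fun n => (res n).1)).
    by rewrite -(mulr0 ((1 + c1) * tau + 1)); apply: cvgM => //; exact: cvg_cst.
  apply: (cvg_of_norm_dist _ (fun n => (res n).2)).
  rewrite -(mulr0 ((1 + c1) * tau ^+ 2 / vrho)) -(mulr0 0).
  by apply: cvgM; [exact: cvg_cst|exact: cvgM].
split=> // uniq.
(* Every null sequence has a weakly convergent subsequence whose limit is a solution, hence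
   [(qd, ud)], and the convergence is strong; the subsequence principle then gives the full
   limit. *)
have sub (d_ : nat -> R) : (forall n, 0 < d_ n) -> d_ n @[n --> \oo] --> 0 ->
    exists phi : nat -> nat, qs (d_ (phi n)) @[n --> \oo] --> qd /\
      us (d_ (phi n)) @[n --> \oo] --> ud.
  move=> d_gt0 d_0.
  have [[phi [hphi [q [u [wq wu]]]]] strong] := main _ d_gt0 d_0.
  exists phi; have [cq cu /uniq[<- <-]] := strong _ _ _ hphi wq wu.
  by split.
by split; apply: cvg_at_right0_subseq => d_ d_gt0 d_0;
  have [phi [? ?]] := sub _ d_gt0 d_0; exists phi.
Qed.
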